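(* Let $X\neq L^\infty$ be a rearrangement invariant (r.i.) space on $[0,1]$ and let $m_X\colon\mathcal{M}\to X$ be the set function $m_X(A):=\mathcal{C}(\chi_A)$, where $\mathcal{C}$ is the Cesàro operator. (a) The measure $m_X$ is $\sigma$-additive. (b) The measure $m_X$ has a strongly measurable, $X$-valued, Pettis $\lambda$-integrable density $F$, given for $\lambda$-a.e. $y\in[0,1]$ (namely for $y\in(0,1]$) by $y\mapsto F_y\in X$ with $F_y(x):=\frac1x\chi_{[y,1]}(x)$, $0<x\le 1$. (c) The measure $m_X$ has $\sigma$-finite variation $|m_X|$, given by $|m_X|(A)=\int_A\|F_y\|_X\,dy$ for $A\in\mathcal{M}$. In the event that $m_X$ has finite variation, $F$ is actually Bochner $\lambda$-integrable. (d) The range $m_X(\mathcal{M})=\{m_X(A):A\in\mathcal{M}\}$ is a relatively compact set in $X$.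
   Context: $\lambda$ is Lebesgue measure on $[0,1]$, $\mathcal{M}$ is the $\sigma$-algebra of Lebesgue measurable subsets of $[0,1]$, $\chi_A$ is the characteristic function of $A$; functions are real-valued. $L^\infty=L^\infty([0,1])$. A Banach function space (B.f.s.) $X$ on $[0,1]$ is a Banach space of ($\lambda$-a.e. classes of) measurable functions on $[0,1]$ such that $g\in X$ and $\|g\|_X\le\|f\|_X$ whenever $f\in X$ and $|g|\le|f|$ a.e. A rearrangement invariant (r.i.) space is a B.f.s. on $[0,1]$ such that if $g^*\le f^*$ and $f\in X$ then $g\in X$ and $\|g\|_X\le\|f\|_X$, where $f^*$ is the decreasing rearrangement of $f$ (the right-continuous inverse of $\tau\mapsto\lambda(\{|f|>\tau\})$). Every r.i. space satisfies $L^\infty\subseteq X\subseteq L^1$. The Fatou property is not assumed. The Cesàro operator is $\mathcal{C}(f)(x):=\frac1x\int_0^x f(t)\,dt$; it maps $L^\infty$ into $L^\infty\subseteq X$, so $m_X$ is well defined and finitely additive. The variation of $m_X$ is $|m_X|(A)=\sup\sum_i\|m_X(A_i)\|_X\in[0,\infty]$, the supremum over finite measurable partitions $(A_i)$ of $A$; $m_X$ has finite variation if $|m_X|([0,1])<\infty$. $F$ being a Pettis density of $m_X$ means that $F$ is Pettis integrable with $m_X(A)=\int_A F_y\,dy$ (Pettis integral) for all $A\in\mathcal{M}$. *)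

(* Defs.v *)
From HB Require Import structures.
From mathcomp Require Import all_boot all_order all_algebra.
From mathcomp Require Import all_classical all_reals all_analysis.
From mathcomp Require Import measurable_realfun lra.
Set Implicit Arguments.
Unset Strict Implicit.
Unset Printing Implicit Defensive.
Import Order.TTheory GRing.Theory Num.Theory numFieldNormedType.Exports.
Local Open Scope classical_set_scope.
Local Open Scope ring_scope.

(* The real line with the sigma-algebra of Lebesgue (not just Borel) measurable
   sets; its carrier is convertible to R. *)
Notation lebT R := (caratheodory_type (@wlength R idfun)^*%mu).
Notation lambda := completed_lebesgue_measure.

Definition I01 (R : realType) : set (lebT R) := [set x : R | 0 <= x <= 1].
Arguments I01 : clear implicits.

Definition lebesgue_sets (R : realType) : set (set (lebT R)) :=
  [set A | measurable A /\ A `<=` I01 R].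
Arguments lebesgue_sets : clear implicits.

(* Functions on [0,1] are represented by total functions of which only the
   values on [0,1] matter. *)
Definition eq01 (R : realType) (f g : lebT R -> R) : Prop :=
  f = g %[ae lambda in I01 R].

Definition le01 (R : realType) (f g : lebT R -> R) : Prop :=
  \forall x \ae lambda, I01 R x -> f x <= g x.

Definition essentially_bounded (R : realType) (f : lebT R -> R) : Prop :=
  exists M : R, le01 (fun x => `|f x|) (cst M).

(* The infimum is taken in \bar R: at t = 0 it is +oo when f is unbounded. *)
Definition decreasing_rearrangement (R : realType) (f : lebT R -> R) (t : R)
    : \bar R :=
  ereal_inf [set tau%:E | tau in
    [set tau : R | 0 <= tau /\
      (lambda (I01 R `&` [set x | (tau < `|f x|)%R]) <= t%:E)%E]].

(* A Banach space of classes of measurable functions on [0,1] is a Banach space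
   X with a map picking a representative rep f of each class f in X; the class
   operations are the pointwise ones, and distinct elements are distinct
   classes. *)
Definition in_space (R : realType) (X : completeNormedModType R)
    (rep : X -> lebT R -> R) (f : lebT R -> R) : Prop :=
  exists g : X, eq01 (rep g) f.

Record banach_function_space (R : realType) (X : completeNormedModType R)
    (rep : X -> lebT R -> R) : Prop := {
  bfs_measurable : forall f : X, measurable_fun (I01 R) (rep f);
  bfs_linear : forall (a : R) (f g : X),
    eq01 (rep (a *: f + g)) (fun x => a * rep f x + rep g x);
  bfs_inj : forall f g : X, eq01 (rep f) (rep g) -> f = g;
  bfs_ideal : forall (f : X) (g : lebT R -> R),
    measurable_fun (I01 R) g ->
    le01 (fun x => `|g x|) (fun x => `|rep f x|) ->
    exists2 h : X, eq01 (rep h) g & `|h| <= `|f| }.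

(* The zero space is excluded: L^oo is a subset of every other such X
   (ri_Linfty below). *)
Record rearrangement_invariant (R : realType) (X : completeNormedModType R)
    (rep : X -> lebT R -> R) : Prop := {
  ri_bfs : banach_function_space rep;
  ri_nonzero : exists f : X, f != 0;
  ri_rearrangement : forall (f : X) (g : lebT R -> R),
    measurable_fun (I01 R) g ->
    (forall t : R, 0 <= t <= 1 ->
      (decreasing_rearrangement g t <= decreasing_rearrangement (rep f) t)%E) ->
    exists2 h : X, eq01 (rep h) g & `|h| <= `|f| }.

Definition is_Linfty (R : realType) (X : completeNormedModType R)
    (rep : X -> lebT R -> R) : Prop :=
  forall f : lebT R -> R, measurable_fun (I01 R) f ->
    (in_space rep f <-> essentially_bounded f).

(* The element of X whose class contains f, and 0 if there is none; for the
   functions cesaro_op \1_A there is one (cesaro_measureE below). *)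
Definition space_class (R : realType) (X : completeNormedModType R)
    (rep : X -> lebT R -> R) (f : lebT R -> R) : X :=
  xget 0 [set g : X | eq01 (rep g) f].

Definition cesaro_op (R : realType) (f : lebT R -> R) (x : lebT R) : R :=
  (x : R)^-1 * \int[lambda]_(t in [set t : lebT R | (0 <= (t : R) <= (x : R))%R]) f t.

Definition cesaro_measure (R : realType) (X : completeNormedModType R)
    (rep : X -> lebT R -> R) (A : set (lebT R)) : X :=
  space_class rep (cesaro_op \1_A).

Lemma borel_lebesgue (R : realType) (A : set R) :
  measurable A -> measurable (A : set (lebT R)).
Proof. exact: (@sub_caratheodory _ _ _ (@wlength R idfun)). Qed.

Lemma I01E (R : realType) : I01 R = [set` `[(0 : R), 1]].
Proof. by apply/seteqP; split => x /=; rewrite in_itv. Qed.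

Lemma measurable_I01 (R : realType) : measurable (I01 R).
Proof. rewrite I01E; exact: borel_lebesgue (measurable_itv _). Qed.

Lemma lambda_I01 (R : realType) : lambda (I01 R) = 1%E.
Proof.
rewrite I01E; have := @lebesgue_measure_itv R `[0, 1].
by rewrite /= lte_fin ltr01 oppr0 adde0.
Qed.

Lemma rep0 (R : realType) (X : completeNormedModType R)
    (rep : X -> lebT R -> R) : banach_function_space rep ->
  eq01 (rep 0) (cst 0).
Proof.
move=> hX; have := bfs_linear hX (-1) 0 0; rewrite scaler0 addr0.
by apply: filterS => x + Ix => /(_ Ix) /=; lra.
Qed.

Lemma bfs_indic (R : realType) (X : completeNormedModType R)
    (rep : X -> lebT R -> R) : rearrangement_invariant rep ->
  exists e d : R, [/\ 0 < e, 0 < d & forall B : set (lebT R),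
    measurable B -> (lambda B <= d%:E)%E ->
    in_space rep (fun x => e * \1_B x)].
Proof.
move=> hX; have hB := ri_bfs hX; have [f f0] := ri_nonzero hX.
pose E (e : R) : set (lebT R) := I01 R `&` [set x | e < `|rep f x|].
have mE e : measurable (E e).
  rewrite /E (_ : [set x | _] = (fun x => `|rep f x|) @^-1` [set` `]e, +oo[]).
    have mf : measurable_fun (I01 R) (fun x => `|rep f x|).
      apply: measurableT_comp => //; exact: bfs_measurable hB f.
    by apply: mf; [exact: measurable_I01|exact: measurable_itv].
  by apply/seteqP; split => x /=; rewrite in_itv/= andbT.
have E1 e : (lambda (E e) <= 1)%E.
  rewrite -(lambda_I01 R); apply: le_measure; rewrite ?inE; [exact: mE| |exact: subIsetl].
  exact: measurable_I01.
have [e e0 Ee] : exists2 e, 0 < e & (0 < lambda (E e))%E.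
  apply: contrapT => no.
  have nE n : lambda (E n.+1%:R^-1) = 0%E.
    apply/eqP; rewrite eq_le measure_ge0 andbT leNgt; apply/negP => En.
    by apply: no; exists n.+1%:R^-1.
  move/eqP: f0; apply; apply: (bfs_inj hB).
  suff f0 : eq01 (rep f) (cst 0).
    by apply: filterS2 f0 (rep0 hB) => x + + Ix => /(_ Ix) -> /(_ Ix) ->.
  have : \forall x \ae (@lambda R), forall n, ~ E n.+1%:R^-1 x.
    apply: ae_foralln => n; exists (E n.+1%:R^-1); split => //=.
    by move=> x /= /contrapT.
  apply: filterS => x nx Ix /=; apply/eqP/negPn/negP => fx0.
  have fx : 0 < `|rep f x| by rewrite normr_gt0.
  have [n _ /(_ n)] := near_infty_natSinv_lt (PosNum fx).
  by rewrite /= leqnn => /(_ isT) fxn; apply: (nx n); split.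
have fE : lambda (E e) \is a fin_num.
  by rewrite ge0_fin_numE//; apply: le_lt_trans (E1 e) _; rewrite ltry.
exists e, (fine (lambda (E e))); split => //; first by rewrite fine_gt0// Ee -ge0_fin_numE.
move=> B mB; rewrite fineK// => BE.
have mg : measurable_fun (I01 R) (fun x => e * \1_B x).
  by apply: (measurable_funM (f := cst e)) => //; exact: measurable_indic.
have [//|t t01|h hg _] := ri_rearrangement hX (f := f) (g := fun x => e * \1_B x).
- apply: ereal_inf_le_tmp => _ [tau [tau0 tauf] <-]; exists tau => //; split => //.
  have [te|et] := ltP tau e.
    apply: le_trans tauf; apply: le_trans (le_trans BE _); apply: le_measure; rewrite ?inE//.
    + rewrite (_ : [set x | _] = (fun x => `|e * \1_B x|) @^-1` [set` `]tau, +oo[]).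
        have mB' : measurable_fun (I01 R) (fun x => `|e * \1_B x|).
          exact: (measurableT_comp (@normr_measurable R setT) mg).
        by apply: mB'; [exact: measurable_I01|exact: measurable_itv].
      by apply/seteqP; split => x /=; rewrite in_itv/= andbT.
    + move=> x [_]/=; rewrite indicE; have [/set_mem//|_] := boolP (x \in B).
      by rewrite mulr0 normr0 ltNge tau0.
    + exact: mE.
    + by move=> x [Ix /= ex]; split => //=; apply: lt_trans ex.
  rewrite (_ : _ `&` _ = set0) ?measure0 ?lee_fin; first by case/andP: t01.
  apply/seteqP; split => x //= [_].
  rewrite normrM gtr0_norm// indicE; case: (x \in B) => /=.
    by rewrite normr1 mulr1 ltNge et.
  by rewrite normr0 mulr0 ltNge tau0.
by exists h.
Qed.

Lemma ri_Linfty (R : realType) (X : completeNormedModType R)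
    (rep : X -> lebT R -> R) (f : lebT R -> R) :
  rearrangement_invariant rep -> measurable_fun (I01 R) f ->
  essentially_bounded f -> in_space rep f.
Proof.
move=> hX mf [M fM]; have hB := ri_bfs hX.
have [e [d [e0 d0 ed]]] := bfs_indic hX.
have step n : exists h : X, \forall x \ae (@lambda R), I01 R x ->
    0 <= rep h x /\ ((x : R) < n%:R * d -> e <= rep h x).
  elim: n => [|n [h hh]].
    exists 0; apply: filterS (rep0 hB) => x + Ix => /(_ Ix) ->; split => //.
    by case/andP: Ix => x0 _; rewrite mul0r ltNge x0.
  pose B := [set` `[n%:R * d, n.+1%:R * d[] : set R.
  have [||k kk] := ed B.
  - exact: borel_lebesgue (measurable_itv _).
  - rewrite [leLHS](@lebesgue_measure_itv R `[n%:R * d, n.+1%:R * d[).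
    rewrite /= lte_fin; case: ifPn => _; last by rewrite lee_fin ltW.
    by rewrite -EFinD lee_fin -mulrBl -natrB// subSnn mul1r.
  exists (1 *: h + k).
  apply: filterS3 (bfs_linear hB 1 h k) hh kk => x xl xh xk Ix.
  rewrite (xl Ix) (xk Ix) mul1r; have [h0 he] := xh Ix; split.
    by rewrite addr_ge0// mulr_ge0// ltW.
  move=> xn; have [/he {}he|nx] := ltP (x : R) (n%:R * d).
    by rewrite -[leLHS]addr0 lerD// mulr_ge0// ltW.
  rewrite indicE mem_set ?mulr1 ?ler_wpDl//.
  by rewrite /B /= in_itv /= nx.
have [n nd] : exists n, 1 < n%:R * d.
  exists (Num.Def.archi_bound d^-1); rewrite -ltr_pdivrMr// mul1r.
  by rewrite archi_boundP// invr_ge0 ltW.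
have [h hh] := step n.
have [k kf _] : exists2 k : X, eq01 (rep k) f & `|k| <= `|(M / e) *: h + 0|.
  apply: (bfs_ideal hB) => //.
  have h0 : eq01 (rep ((M / e) *: h + 0)) (fun x => M / e * rep h x).
    apply: filterS2 (bfs_linear hB (M / e) h 0) (rep0 hB) => x + + Ix.
    by move=> /(_ Ix) -> /(_ Ix) ->; rewrite addr0.
  apply: filterS3 h0 hh fM => x xk xh fx Ix; rewrite (xk Ix).
  have [h0 he'] := xh Ix.
  have he : e <= rep h x by apply: he'; case/andP: Ix => _ /le_lt_trans; exact.
  have M0 : 0 <= M by apply: le_trans (fx Ix).
  apply: le_trans (fx Ix) (le_trans _ (ler_norm _)).
  by rewrite mulrAC ler_pdivlMr// ler_wpM2l.
by exists k.
Qed.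

Lemma cesaro_indic (R : realType) (A : set (lebT R)) (x : R) :
  lebesgue_sets R A ->
  cesaro_op \1_A x = x^-1 * fine (lambda (A `&` [set t : R | 0 <= t <= x])).
Proof.
move=> [mA _]; rewrite /cesaro_op /Rintegral integral_indic//.
rewrite (_ : mkset _ = [set` `[0, x]]); first exact: borel_lebesgue (measurable_itv _).
by apply/seteqP; split => t /=; rewrite in_itv.
Qed.

Lemma cesaro_measureE (R : realType) (X : completeNormedModType R)
    (rep : X -> lebT R -> R) (A : set (lebT R)) :
  rearrangement_invariant rep -> lebesgue_sets R A ->
  eq01 (rep (cesaro_measure rep A)) (cesaro_op \1_A).
Proof.
move=> hX hA; have [mA AI] := hA.
pose J (x : R) : set (lebT R) := [set t : R | 0 <= t <= x].
have mJ x : measurable (J x).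
  rewrite (_ : J x = [set` `[0, x]]); first exact: borel_lebesgue (measurable_itv _).
  by apply/seteqP; split => t /=; rewrite in_itv.
have mAJ x : measurable (A `&` J x) by exact: measurableI.
have AJ1 x : (lambda (A `&` J x) <= 1)%E.
  rewrite -(lambda_I01 R); apply: le_measure; rewrite ?inE//.
    exact: measurable_I01.
  by apply: subset_trans AI; exact: subIsetl.
have fAJ x : lambda (A `&` J x) \is a fin_num.
  by rewrite ge0_fin_numE//; apply: le_lt_trans (AJ1 x) _; rewrite ltry.
suff /(xgetPex 0) : exists g, [set g : X | eq01 (rep g) (cesaro_op \1_A)] g by [].
apply: ri_Linfty => //.
  apply: (eq_measurable_fun
    (fun x : lebT R => (x : R) `^ (-1) * fine (lambda (A `&` J x)))).
    move=> x /set_mem /andP[x0 _].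
    by rewrite cesaro_indic// powR_inv1.
  apply: measurable_funM.
    move=> _ B mB; apply: measurableI; first exact: measurable_I01.
    apply: borel_lebesgue; rewrite -[X in measurable X]setTI.
    exact: measurable_powR.
  move=> _ B mB; apply: measurableI; first exact: measurable_I01.
  apply: borel_lebesgue; rewrite -[X in measurable X]setTI.
  apply: nondecreasing_measurable => // x y xy.
  rewrite fine_le// le_measure ?inE//.
  by apply: setIS => t /andP[t0 tx]; apply/andP; split => //; exact: le_trans xy.
exists 1; apply: aeW => x /andP[x0 _].
rewrite cesaro_indic// ger0_norm ?mulr_ge0 ?invr_ge0 ?fine_ge0//=.
move: x0; rewrite le_eqVlt => /predU1P[<-|x0]; first by rewrite invr0 mul0r.
rewrite ler_pdivrMl// mulr1 -lee_fin fineK; last exact: fAJ.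
apply: (@le_trans _ _ (lambda (J x))); first by apply: le_measure; rewrite ?inE; [exact: mAJ|exact: mJ|exact: subIsetr].
have -> : J x = [set` `[0, x]].
  by apply/seteqP; split => t /=; rewrite in_itv.
by rewrite [leLHS](@lebesgue_measure_itv R `[0, x]) /= lte_fin x0 oppr0 adde0.
Qed.

Section vector_measures.
Context {R : realType} {V : normedModType R}.
Implicit Types (m : set (lebT R) -> V) (F : lebT R -> V).

Definition vector_sigma_additive m : Prop :=
  forall A : nat -> set (lebT R),
    (forall n, lebesgue_sets R (A n)) -> trivIset setT A ->
    \sum_(k < n) m (A k) @[n --> \oo] --> m (\bigcup_n A n).

Definition vector_variation m (A : set (lebT R)) : \bar R :=
  ereal_sup [set (\sum_(i < n.1) `|m (n.2 i)|)%:E | n in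
    [set P : nat * (nat -> set (lebT R)) |
      [/\ forall i, (i < P.1)%N -> lebesgue_sets R (P.2 i),
          trivIset `I_P.1 P.2 &
          \bigcup_(i < P.1) P.2 i = A]]].

Definition finite_variation m : Prop := (vector_variation m (I01 R) < +oo)%E.

Definition sigma_finite_variation m : Prop := sigma_finite (I01 R) (vector_variation m).

Definition simple_function (s : lebT R -> V) : Prop :=
  finite_set (s @` I01 R) /\
  forall v : V, measurable (I01 R `&` s @^-1` [set v]).

Definition strongly_measurable F : Prop :=
  exists s : nat -> lebT R -> V,
    (forall n, simple_function (s n)) /\
    (\forall x \ae lambda, I01 R x -> s n x @[n --> \oo] --> F x).

Definition bochner_integrable F : Prop :=
  strongly_measurable F /\
  exists s : nat -> lebT R -> V,
    (forall n, simple_function (s n)) /\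
    (\int[lambda]_(x in I01 R) (`|F x - s n x|%R)%:E)%E @[n --> \oo] --> 0%E.

Definition is_pettis_integral F (A : set (lebT R)) (v : V) : Prop :=
  forall phi : {linear V -> R^o}, continuous phi ->
    lambda.-integrable A (fun x => (phi (F x))%:E) /\
    (\int[lambda]_(x in A) (phi (F x))%:E)%E = (phi v)%:E.

Definition pettis_integrable F : Prop :=
  (forall phi : {linear V -> R^o}, continuous phi ->
    lambda.-integrable (I01 R) (fun x => (phi (F x))%:E)) /\
  (forall A, lebesgue_sets R A -> exists v, is_pettis_integral F A v).

Definition pettis_density F m : Prop :=
  pettis_integrable F /\
  (forall A, lebesgue_sets R A -> is_pettis_integral F A (m A)).

End vector_measures.

(* Main.v *)
(* In a rearrangement invariant X other than L^oo, an unbounded f in X bounds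
   the norm of the indicator of a small set B: n \1_B is rearranged below f as
   soon as lambda B <= lambda {|f| > n}. Hence for 0 < a <= y <= z the norm of
   F_y - F_z, which is at most a^-1 \1_[y,z[, is small when z - y is, so that F
   is norm continuous on ]0, 1]; likewise m_X(A) - lambda(A) F_z is small with
   respect to lambda(A) for A included in [y, z[; and the norm of m_X(A) is
   small when lambda(A) is, since m_X(A) <= \1_[0,d] + d^-1 lambda(A). From these
   estimates alone, cutting [a, 1] into short cells gives
   phi(m_X(A)) = int_A phi(F) for A in [a, 1] and phi in the dual, the formula
   for the variation, and finite nets of the range; letting a tend to 0 gives
   the general case. Step functions built on right endpoints of cells are
   dominated by F because |F| is nonincreasing, whence Bochner integrability. *)
Require Import Defs.
From HB Require Import structures.
From mathcomp Require Import all_boot all_order all_algebra.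
From mathcomp Require Import all_classical all_reals all_analysis.
From mathcomp Require Import measurable_realfun lra.
Set Implicit Arguments.
Unset Strict Implicit.
Unset Printing Implicit Defensive.
Import Order.TTheory GRing.Theory Num.Theory numFieldNormedType.Exports.
Local Open Scope classical_set_scope.
Local Open Scope ring_scope.

(** * Total boundedness and continuous functionals *)

(** An ultrafilter containing the closure of [S] is Cauchy: if it contained no ball of radius [e]
    around the finite net, it would contain all their complements, hence the finite intersection of
    these, which misses the closure. Completeness provides the limit. *)
Lemma totally_bounded_precompact (R : realType) (V : completeNormedModType R)
    (S : set V) :
  (forall e : R, 0 < e -> exists2 C : set V, finite_set C &
    forall x, S x -> exists2 c, C c & `|x - c| <= e) ->
  precompact S.
Proof.
move=> tbS; rewrite precompactE compact_ultra => U UU US.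
have cU : cauchy U.
  apply/cauchyP => e e0.
  have e20 : 0 < e / 2 by rewrite divr_gt0.
  have [C finC SC] := tbS (e / 2) e20.
  (* The net has radius [e / 2]; the other half is spent in passing from [S] to its closure. *)
  have SCe : closure S `<=` \bigcup_(c in C) ball c e.
    move=> x /(_ (ball x (e / 2))) []; first exact: nbhsx_ballx.
    move=> s [Ss]; rewrite -ball_normE /= => xs.
    have [c Cc sc] := SC _ Ss; exists c => //; rewrite /= distrC.
    rewrite (splitr e) (le_lt_trans (ler_distD s _ _))//.
    exact: ltr_leD.
  apply: contrapT => noball.
  have nball c : U (~` ball c e).
    by have [Uc|//] := in_ultra_setVsetC (ball c e) UU; case: noball; exists c.
  have [s Cs] := (finite_seqP C).1 finC.
  suff /filter_ex[x] : U (\bigcap_(c in C) ~` ball c e `&` closure S).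
    by move=> [nx /SCe[c Cc]]; exact: nx.
  apply: filterI => //; rewrite Cs.
  elim: s {Cs} => [|c s IH]; first by apply: filterS filterT => x _ c.
  apply: filterS2 (nball c) IH => x xc xs d /=; rewrite inE => /predU1P[->//|].
  exact: xs.
have cvU : cvg U by exact: cauchy_cvg.
exists (lim U); split => //.
rewrite (closure_id (closure S)).1; last exact: closed_closure.
move=> B /cvU UB; have : U (closure S `&` B) by apply: filterI.
by move=> /filter_ex[x [? ?]]; exists x.
Qed.

Lemma continuous_linear_lipschitz (R : realType) (V : normedModType R)
    (phi : {linear V -> R^o}) :
  continuous phi ->
  exists2 C, 0 <= C & forall v w, `|phi v - phi w| <= C * `|v - w|.
Proof.
move=> /linear_bounded_continuous/linear_boundedP [M [_ bM]].
exists (`|M| + 1) => [|v w]; first by rewrite addr_ge0.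
rewrite -raddfB; apply: bM.
by rewrite ltr_pwDr// ler_norm.
Qed.

(** * Lebesgue sets of [0,1] and their uniform cells *)

Lemma borel_lebesgue_fun d (T : measurableType d) (R : realType) (D : set R)
    (f : R -> T) :
  measurable D -> measurable_fun D f -> measurable_fun (D : set (lebT R)) f.
Proof. by move=> mD mf _ B mB; apply: borel_lebesgue; exact: mf. Qed.

Lemma lebesgue_itv (R : realType) (i : interval R) :
  measurable ([set` i] : set (lebT R)).
Proof. exact: borel_lebesgue (measurable_itv i). Qed.

(** On [lebesgue_sets] the measure is at most 1, so [fine] loses nothing there. *)
Definition mes (R : realType) (A : set (lebT R)) : R := fine (lambda A).

Section lebesgue_sets_theory.
Context {R : realType}.
Implicit Types A B : set (lebT R).

Lemma leb_measurable A : lebesgue_sets R A -> measurable A.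
Proof. by case. Qed.

Lemma leb_I01 : lebesgue_sets R (I01 R).
Proof. by split => //; exact: measurable_I01. Qed.

Lemma leb_set0 : lebesgue_sets R set0.
Proof. by split => //; exact: sub0set. Qed.

Lemma leb_setI A B : lebesgue_sets R A -> measurable B -> lebesgue_sets R (A `&` B).
Proof.
by move=> [mA AI] mB; split; [exact: measurableI|move=> x [/AI]].
Qed.

Lemma leb_setD A B : lebesgue_sets R A -> measurable B -> lebesgue_sets R (A `\` B).
Proof.
by move=> [mA AI] mB; split; [exact: measurableD|move=> x [/AI]].
Qed.

Lemma leb_setU A B :
  lebesgue_sets R A -> lebesgue_sets R B -> lebesgue_sets R (A `|` B).
Proof.
by move=> [mA AI] [mB BI]; split; [exact: measurableU|move=> x [/AI|/BI]].
Qed.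

Lemma leb_bigcup (A : nat -> set (lebT R)) :
  (forall n, lebesgue_sets R (A n)) -> lebesgue_sets R (\bigcup_n A n).
Proof.
move=> lA; split; first by apply: bigcupT_measurable => n; exact: (lA n).1.
by move=> x [n _ /(lA n).2].
Qed.

Lemma leb_bigsetU (A : nat -> set (lebT R)) k :
  (forall n, lebesgue_sets R (A n)) -> lebesgue_sets R (\big[setU/set0]_(i < k) A i).
Proof.
by move=> lA; elim/big_ind : _ => //; [exact: leb_set0|exact: leb_setU].
Qed.

Lemma leb_le1 A : lebesgue_sets R A -> (lambda A <= 1)%E.
Proof.
move=> [mA AI]; rewrite -(lambda_I01 R); apply: le_measure; rewrite ?inE//.
exact: measurable_I01.
Qed.

Lemma leb_ltoo A : lebesgue_sets R A -> (lambda A < +oo)%E.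
Proof. by move=> lA; apply: le_lt_trans (leb_le1 lA) _; rewrite ltry. Qed.

Lemma leb_fin A : lebesgue_sets R A -> lambda A \is a fin_num.
Proof. by move=> lA; rewrite ge0_fin_numE// leb_ltoo. Qed.

Lemma mesE A : lebesgue_sets R A -> lambda A = (mes A)%:E.
Proof. by move=> lA; rewrite fineK// leb_fin. Qed.

Lemma mes_ge0 A : 0 <= mes A.
Proof. exact: fine_ge0. Qed.

Lemma mes_le1 A : lebesgue_sets R A -> mes A <= 1.
Proof. by move=> lA; rewrite -lee_fin -mesE// leb_le1. Qed.

Lemma mesU A B : lebesgue_sets R A -> lebesgue_sets R B -> A `&` B = set0 ->
  mes (A `|` B) = mes A + mes B.
Proof.
move=> lA lB AB; apply: EFin_inj; rewrite EFinD -!mesE//; last exact: leb_setU.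
by rewrite measureU//; exact: leb_measurable.
Qed.

Lemma mes_bigsetU (A : nat -> set (lebT R)) k :
  (forall n, lebesgue_sets R (A n)) -> trivIset setT A ->
  mes (\big[setU/set0]_(i < k) A i) = \sum_(i < k) mes (A i).
Proof.
move=> lA tA; apply: EFin_inj; rewrite -mesE ?measure_bigsetU//.
- by rewrite -sumEFin; apply: eq_bigr => i _; exact: mesE.
- by move=> i; exact: leb_measurable.
- exact: leb_bigsetU.
Qed.

Lemma lambda_set1 (a : R) : lambda ([set a] : set (lebT R)) = 0%E.
Proof. exact: (lebesgue_measure_set1 a). Qed.

Lemma ae_I01_gt0 : \forall x \ae (@lambda R), I01 R x -> 0 < (x : R).
Proof.
exists [set (0 : R)]; split; last 1 first.
- move=> x /= /not_implyP [/andP[x0 _] /negP]; rewrite -leNgt => x0'.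
  by apply/eqP; rewrite eq_le x0 x0'.
- exact: borel_lebesgue (measurable_set1 0).
- exact: lambda_set1.
Qed.

Lemma mes_le A B : lebesgue_sets R A -> lebesgue_sets R B -> A `<=` B ->
  mes A <= mes B.
Proof.
move=> lA lB AB; rewrite -lee_fin -!mesE// le_measure// inE; exact: leb_measurable.
Qed.

Definition cell (n i : nat) : set (lebT R) :=
  [set` `[i%:R / n.+1%:R, i.+1%:R / n.+1%:R[ : interval R].

Lemma measurable_cell n i : measurable (cell n i).
Proof. exact: lebesgue_itv. Qed.

Lemma cellP n i (y : R) : 0 <= y ->
  cell n i y <-> Num.truncn (y * n.+1%:R) = i.
Proof.
move=> y0; rewrite /cell /= in_itv /= ler_pdivrMr// ltr_pdivlMr//.
by rewrite -truncn_eq ?mulr_ge0//; split => [/eqP|/eqP].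
Qed.

(** Cells are half-open of length 1/(n+1), so the point 1 falls into the cell of index n+1; this is
    why there are n+2 of them. *)
Lemma cell_cover n A : A `<=` I01 R ->
  \big[setU/set0]_(i < n.+2) (A `&` cell n i) = A.
Proof.
move=> AI; rewrite -(bigcup_mkord n.+2 (fun i => A `&` cell n i)).
apply/seteqP; split => [x [i _ []//]|x Ax].
have /andP[x0 x1] := AI _ Ax.
exists (Num.truncn ((x : R) * n.+1%:R)); last by split => //; exact/cellP.
rewrite /= truncn_lt_nat ?mulr_ge0// (@le_lt_trans _ _ n.+1%:R)// ?ltr_nat//.
by rewrite -[leRHS]mul1r ler_wpM2r.
Qed.

Lemma cell_triv n A : A `<=` I01 R -> trivIset setT (fun i => A `&` cell n i).
Proof.
move=> AI i j _ _ [x [[Ax xi] [_ xj]]]; have /andP[x0 _] := AI _ Ax.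
by rewrite -((cellP n i x0).1 xi) -((cellP n j x0).1 xj).
Qed.

Lemma leb_cell n i A : lebesgue_sets R A -> lebesgue_sets R (A `&` cell n i).
Proof. by move=> lA; apply: leb_setI => //; exact: measurable_cell. Qed.

Lemma mes_cells n A : lebesgue_sets R A ->
  \sum_(i < n.+2) mes (A `&` cell n i) = mes A.
Proof.
move=> lA; rewrite -[in RHS](cell_cover n lA.2).
by rewrite (mes_bigsetU n.+2 (A := fun i => A `&` cell n i))//;
  [move=> i; exact: leb_cell|exact: cell_triv lA.2].
Qed.

(** The right endpoint of a cell: it is positive even for the first cell, where the left endpoint 0
    would be a bad point for [F]. The last one exceeds 1. *)
Definition grid (n i : nat) : R := i.+1%:R / n.+1%:R.

Lemma grid_gt0 n i : 0 < grid n i.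
Proof. by rewrite divr_gt0. Qed.

Lemma cell_grid n i (y : R) : cell n i y -> grid n i - n.+1%:R^-1 <= y < grid n i.
Proof.
rewrite /cell /grid /= in_itv /= => /andP[iy ->]; rewrite andbT.
by rewrite -[X in _ - X]mul1r -mulrBl -[i.+1%:R]natr1 addrK.
Qed.

Definition up_grid n (y : R) : R := grid n (Num.truncn (y * n.+1%:R)).

Lemma up_gridP n (y : R) : 0 <= y -> up_grid n y - n.+1%:R^-1 <= y < up_grid n y.
Proof. by move=> y0; apply: cell_grid; apply/cellP. Qed.

End lebesgue_sets_theory.

(* These properties of F, relative to m, hold only away from 0: F may be
   unbounded near 0, and its values outside ]0, 1] are irrelevant. *)
Record local_density (R : realType) (V : normedModType R)
    (m : set (lebT R) -> V) (F : lebT R -> V) : Prop := {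
  ld_add : forall A B, lebesgue_sets R A -> lebesgue_sets R B ->
    A `&` B = set0 -> m (A `|` B) = m A + m B;
  ld_small : forall e : R, 0 < e -> exists2 d : R, 0 < d &
    forall A, lebesgue_sets R A -> mes A <= d -> `|m A| <= e;
  ld_local : forall a e : R, 0 < a -> 0 < e -> exists2 h : R, 0 < h &
    forall z : R, 0 < z ->
      (forall y : R, a <= y -> z - h <= y <= z -> `|F y - F z| <= e) /\
      (forall A, lebesgue_sets R A ->
        (forall y : R, A y -> a <= y /\ z - h <= y < z) ->
        `|m A - mes A *: F z| <= e * mes A);
  ld_decr : forall y z : R, 0 < y <= z -> `|F z| <= `|F y| }.

(** * Cell approximation for a set function with a local density *)

Section local_density_theory.
Context {R : realType} {V : normedModType R}.
Variables (m : set (lebT R) -> V) (F : lebT R -> V).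
Hypothesis mF : local_density m F.
Implicit Types A B : set (lebT R).

Lemma ld_set0 : m set0 = 0.
Proof.
have := ld_add mF (leb_set0 (R := R)) (leb_set0 (R := R)) (setI0 _).
by rewrite setU0 => /eqP; rewrite -subr_eq0 opprD addNKr oppr_eq0 => /eqP.
Qed.

Lemma ld_bigsetU (A : nat -> set (lebT R)) k :
  (forall n, lebesgue_sets R (A n)) -> trivIset setT A ->
  m (\big[setU/set0]_(i < k) A i) = \sum_(i < k) m (A i).
Proof.
move=> lA tA; elim: k => [|k IH]; first by rewrite !big_ord0 ld_set0.
rewrite !big_ord_recr/= (ld_add mF) ?IH//; first exact: leb_bigsetU.
apply: (@trivIset_bigsetUI _ xpredT A) => //.
by move=> i j _ _; exact: tA.
Qed.

Lemma ld_cells n A : lebesgue_sets R A ->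
  \sum_(i < n.+2) m (A `&` cell n i) = m A.
Proof.
move=> lA; rewrite -[in RHS](cell_cover n lA.2).
by rewrite (@ld_bigsetU (fun i => A `&` cell n i))//;
  [move=> i; exact: leb_cell|exact: cell_triv lA.2].
Qed.

Lemma ld_setD A B : lebesgue_sets R A -> lebesgue_sets R B -> B `<=` A ->
  m A - m B = m (A `\` B).
Proof.
move=> lA lB BA; rewrite -[in LHS](setDUK BA) (ld_add mF)//.
- by rewrite addrAC subrr add0r.
- exact: leb_setD lA (leb_measurable lB).
- exact: setDIK.
Qed.

Lemma natSinv_small (h : R) : 0 < h ->
  exists N, forall n, (N <= n)%N -> n.+1%:R^-1 <= h.
Proof.
move=> h0; have [N _ NP] := near_infty_natSinv_lt (PosNum h0).
by exists N => n /NP/ltW.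
Qed.

Lemma mes_itv A (a b : R) : lebesgue_sets R A -> a <= b ->
  A `<=` [set` `[a, b]] -> mes A <= b - a.
Proof.
move=> lA ab Aab; rewrite -lee_fin -mesE//.
apply: (@le_trans _ _ (lambda ([set` `[a, b]] : set (lebT R)))).
  rewrite le_measure// inE; [exact: leb_measurable|exact: lebesgue_itv].
rewrite [leLHS](@lebesgue_measure_itv R `[a, b]) /= lte_fin.
by case: ifPn => // _; rewrite lee_fin subr_ge0.
Qed.

Lemma mes_cell n i A : lebesgue_sets R A -> mes (A `&` cell n i) <= n.+1%:R^-1.
Proof.
move=> lA; have -> : n.+1%:R^-1 = grid n i - (grid n i - n.+1%:R^-1) :> R.
  by rewrite opprB addrCA subrr addr0.
apply: mes_itv; [exact: leb_cell|by rewrite gerBl|].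
by move=> x [_ /cell_grid/andP[xi ix]]; rewrite /= in_itv/= xi ltW.
Qed.

(** On cells short enough for [ld_small] at 1, each piece has norm at most 1, so the number of cells
    is a bound. *)
Lemma ld_bounded : exists M, forall A, lebesgue_sets R A -> `|m A| <= M.
Proof.
have [d d0 md] := ld_small mF (@ltr01 R).
have [n /(_ n (leqnn n)) nd] := natSinv_small d0.
exists (n.+2)%:R => A lA; rewrite -(ld_cells n lA).
apply: le_trans (ler_norm_sum _ _ _) _.
rewrite -[X in X%:R]card_ord -sum1_card natr_sum; apply: ler_sum => i _.
apply: md; first exact: leb_cell.
exact: le_trans (mes_cell _ _ lA) nd.
Qed.

Lemma ld_continuous (y : R) : 0 < y -> {for y, continuous (F : R -> V)}.
Proof.
move=> y0; apply/cvgrPdist_le => e e0.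
have y20 : 0 < y / 2 by rewrite divr_gt0.
have [h h0 hF] := ld_local mF y20 e0.
near=> x.
have xy : `|y - x| < y / 2 by near: x; apply: cvgr_dist_lt.
have xh : `|y - x| < h by near: x; apply: cvgr_dist_lt.
move: xy xh; rewrite !ltr_norml => /andP[xy1 xy2] /andP[xh1 xh2].
(* [ld_local] is one-sided, so the larger of the two points serves as its [z]; both stay above
   [y / 2]. *)
have [xy|xy] := leP x y.
  by rewrite distrC; apply: (hF y _).1; lra.
by apply: (hF x _).1; lra.
Unshelve. all: by end_near. Qed.

(** [F] is continuous on the positive half-line, and the only other point of [0,1] is 0, a single
    point. *)
Lemma ld_measurable (g : V -> R) : continuous g ->
  measurable_fun (I01 R) (fun x => g (F x)).
Proof.
move=> cg.
have E : I01 R `<=` ([set (0 : R)] `|` [set` `]0, +oo[ : interval R]).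
  move=> x /andP[x0 _]; rewrite le_eqVlt in x0.
  by case/predU1P : x0 => [<-|x0]; [left|right; rewrite /= in_itv/= x0].
have m0 : measurable ([set (0 : R)] : set (lebT R)).
  exact: borel_lebesgue (measurable_set1 0).
apply: measurable_funS E _; first by apply: measurableU => //; exact: lebesgue_itv.
apply/measurable_funU => //; first exact: lebesgue_itv.
split; first exact: measurable_fun_set1.
apply: (@borel_lebesgue_fun _ _ _ `]0, +oo[%classic (fun x : R => g (F x))).
  exact: measurable_itv.
apply: open_continuous_measurable_fun; first exact: interval_open.
move=> x /set_mem; rewrite /= in_itv/= andbT => x0.
apply: continuous_comp; first exact: ld_continuous.
exact: cg.
Qed.

(** A common class for the norm and the continuous functionals, so that one cell estimate serves
    both the variation and the Pettis integral. Homogeneity is asked only of nonnegative scalars, as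
    the norm requires; the scalars met are measures. *)
Definition lipschitz_homogeneous (C : R) (g : V -> R) : Prop :=
  [/\ 0 <= C, continuous g, forall v w, `|g v - g w| <= C * `|v - w| &
      forall (c : R) v, 0 <= c -> g (c *: v) = c * g v].

Lemma ld_integrable C g (a : R) A : lipschitz_homogeneous C g -> 0 < a ->
  lebesgue_sets R A -> A `<=` [set` `[a, +oo[ : interval R] ->
  lambda.-integrable A (fun x => (g (F x))%:E).
Proof.
move=> [C0 cg gC gZ] a0 lA Aa.
apply: measurable_bounded_integrable.
- exact: leb_measurable.
- exact: leb_ltoo.
- apply: measurable_funS (ld_measurable cg); [exact: measurable_I01|exact: lA.2].
exists (C * `|F a|); split => [|M /ltW CM x Ax]; first exact: num_real.
apply: le_trans CM; have := gC (F x) 0.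
have -> : g 0 = 0 by rewrite -(scale0r 0) gZ// mul0r.
rewrite !subr0 => /le_trans; apply; apply: ler_wpM2l => //.
by apply: (ld_decr mF); have := Aa _ Ax; rewrite /= in_itv/= andbT a0.
Qed.

Lemma Rintegral_cells n A (f : lebT R -> R) : lebesgue_sets R A ->
  lambda.-integrable A (EFin \o f) ->
  \int[lambda]_(x in A) f x = \sum_(i < n.+2) \int[lambda]_(x in A `&` cell n i) f x.
Proof.
move=> lA fi.
have fin i : lambda.-integrable (A `&` cell n i) (EFin \o f).
  apply: integrableS fi; [exact: leb_measurable| |exact: subIsetl].
  exact: leb_measurable (leb_cell n i lA).
have fin' B : lambda.-integrable B (EFin \o f) -> measurable B ->
    (\int[lambda]_(x in B) f x)%:E = (\int[lambda]_(x in B) (f x)%:E)%E.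
  by move=> fB mB; rewrite fineK//; exact: integrable_fin_num.
apply: EFin_inj; rewrite fin'//; last exact: leb_measurable.
rewrite -[X in (\int[lambda]_(x in X) _)%E](cell_cover n lA.2).
rewrite -(big_mkord xpredT (fun i => A `&` cell n i)).
rewrite integral_bigsetU_EFin ?iota_uniq//.
- rewrite big_mkord -sumEFin; apply: eq_bigr => i _.
  by rewrite fin'//; exact: leb_measurable (leb_cell n i lA).
- by move=> i; exact: leb_measurable (leb_cell n i lA).
- by apply: sub_trivIset (cell_triv (n := n) lA.2).
- rewrite big_mkord (cell_cover n lA.2).
  exact: measurable_int fi.
Qed.

(** On the part [B] of [A] in a cell, both [g (m B)] and the integral of [g (F x)] differ from
    [mes B * g (F (grid n i))] by at most [C * e * mes B]: the first by the estimate on [m], the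
    second by the oscillation of [F]. Summing over the cells gives the factor 2. *)
Lemma cell_approx C g (a e : R) : lipschitz_homogeneous C g -> 0 < a -> 0 < e ->
  exists N, forall n, (N <= n)%N -> forall A, lebesgue_sets R A ->
    A `<=` [set` `[a, +oo[ : interval R] ->
    `|\sum_(i < n.+2) g (m (A `&` cell n i)) - \int[lambda]_(x in A) g (F x)|
      <= 2 * C * e * mes A.
Proof.
move=> Cg a0 e0; have [C0 cg gC gZ] := Cg.
have [h h0 hF] := ld_local mF a0 e0; have [N Nh] := natSinv_small h0.
exists N => n /Nh nh A lA Aa.
rewrite (Rintegral_cells n lA); last exact: ld_integrable Cg a0 lA Aa.
rewrite -sumrB -(mes_cells n lA) mulr_sumr.
apply: le_trans (ler_norm_sum _ _ _) _; apply: ler_sum => i _.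
set B := A `&` cell n i; have lB : lebesgue_sets R B by exact: leb_cell.
have mB := leb_measurable lB.
have [hF1 hF2] := hF _ (grid_gt0 n i).
have Bz (y : R) : B y -> a <= y /\ grid n i - h <= y < grid n i.
  move=> [/Aa + /cell_grid]; rewrite /= in_itv/= andbT => -> /andP[y1 ->].
  by split => //; rewrite andbT (le_trans _ y1)// lerD2l lerN2.
have Bi : lambda.-integrable B (fun x => (g (F x))%:E).
  by apply: (ld_integrable Cg a0 lB) => x [/Aa].
have ci (c : R) : lambda.-integrable B (EFin \o cst c).
  apply: measurable_bounded_integrable => //; first exact: leb_ltoo.
  by exists `|c|; split => [|M /ltW + x _]; rewrite ?num_real.
rewrite -(subrKA (mes B * g (F (grid n i)))).
rewrite [2 * C * e]mulrAC -!mulrA mulr_natl mulr2n.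
apply: le_trans (ler_normD _ _) _; apply: lerD.
  rewrite -gZ ?mes_ge0// mulrCA.
  apply: le_trans (gC _ _) _; rewrite ler_wpM2l//.
  exact: hF2.
rewrite mulrC -(Rintegral_cst lambda mB).
rewrite -RintegralB//; last exact: ci.
have gi : lambda.-integrable B (EFin \o (fun x => g (F (grid n i)) - g (F x))).
  exact: integrableB (ci _) Bi.
apply: le_trans (le_normr_Rintegral mB gi) _.
rewrite -/(mes B) mulrCA mulrA -[leRHS](Rintegral_cst lambda mB).
apply: le_Rintegral => //; [exact: integrable_norm gi|exact: ci|].
move=> x Bx; apply: le_trans (gC _ _) _; rewrite /= ler_wpM2l//.
rewrite distrC; apply: hF1; have [? /andP[? ?]] := Bz _ Bx => //.
by apply/andP; split => //; exact: ltW.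

Qed.

End local_density_theory.

(** * Exhaustion of a set by its parts away from 0 *)

Definition tail (R : realType) (A : set (lebT R)) (n : nat) : set (lebT R) :=
  A `&` [set` `[n.+1%:R^-1, +oo[ : interval R].

Section tails.
Context {R : realType}.
Implicit Types A B : set (lebT R).

Lemma leb_tail A n : lebesgue_sets R A -> lebesgue_sets R (tail A n).
Proof. by move=> lA; apply: leb_setI => //; exact: lebesgue_itv. Qed.

Lemma tail_sub A n : tail A n `<=` [set` `[n.+1%:R^-1, +oo[ : interval R].
Proof. by move=> x []. Qed.

Lemma tail_subl A n : tail A n `<=` A.
Proof. by move=> x []. Qed.

Lemma tail_bigcup A : A `<=` I01 R -> \bigcup_n tail A n = A `\` [set (0 : R)].
Proof.
move=> AI; apply/seteqP; split => x.
  move=> [n _ [Ax]]; rewrite /= in_itv/= andbT => nx; split => //= x0.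
  by move: nx; rewrite x0 leNgt invr_gt0 ltr0Sn.
move=> [Ax /= /eqP x0]; have /andP[x_ge0 _] := AI _ Ax.
have xgt0 : 0 < (x : R) by rewrite lt_neqAle eq_sym x0.
have [N /(_ N (leqnn N)) Nx] := natSinv_small xgt0.
by exists N => //; split => //; rewrite /= in_itv/= andbT.
Qed.

(** Monotone convergence, since the tails increase to [A] without the null set {0}. *)
Lemma integral_tail_cvg A (f : lebT R -> R) : lebesgue_sets R A ->
  measurable_fun (I01 R) f -> (forall x, 0 <= f x) ->
  (\int[lambda]_(x in tail A n) (f x)%:E)%E @[n --> \oo] -->
  (\int[lambda]_(x in A) (f x)%:E)%E.
Proof.
move=> lA mf f0.
have mfB B : lebesgue_sets R B -> measurable_fun B (EFin \o f).
  move=> lB; apply/measurable_EFinP; apply: measurable_funS mf.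
    exact: measurable_I01.
  exact: lB.2.
rewrite (@ge0_negligible_integral _ _ _ lambda A [set (0 : R)])//.
- rewrite -(tail_bigcup lA.2).
  apply: ge0_nondecreasing_set_cvg_integral => //.
  + move=> n k nk; rewrite subsetEset => x [Ax]; rewrite /= in_itv/= andbT => nx.
    split => //; rewrite /= in_itv/= andbT; apply: le_trans nx.
    by rewrite lef_pV2 ?posrE// ler_nat.
  + by move=> n; exact: leb_measurable (leb_tail n lA).
  + by move=> n; apply: mfB; exact: leb_tail.
  + by move=> *; rewrite lee_fin.
- exact: borel_lebesgue (measurable_set1 0).
- exact: leb_measurable.
- exact: mfB.
- by move=> *; rewrite lee_fin.
- exact: lambda_set1.
Qed.

End tails.

(** * Pettis integrability of the density *)

Section local_density_integrals.
Context {R : realType} {V : normedModType R}.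
Variables (m : set (lebT R) -> V) (F : lebT R -> V).
Hypothesis mF : local_density m F.
Implicit Types A B : set (lebT R).

Lemma ld_tail (e : R) : 0 < e -> exists N, forall n, (N <= n)%N ->
  forall A, lebesgue_sets R A -> `|m A - m (tail A n)| <= e.
Proof.
move=> e0; have [d d0 md] := ld_small mF e0.
have [N Nd] := natSinv_small d0; exists N => n /Nd nd A lA.
have lT := leb_tail n lA.
rewrite (ld_setD mF lA lT); last exact: tail_subl.
apply: md; first exact: leb_setD lA (leb_measurable lT).
apply: le_trans nd; rewrite -[leRHS]subr0; apply: mes_itv.
- exact: leb_setD lA (leb_measurable lT).
- by rewrite invr_ge0.
- move=> x [Ax nx]; have /andP[x0 _] := lA.2 _ Ax; rewrite /= in_itv/= x0/= leNgt.
  by apply/negP => nx'; apply: nx; split => //; rewrite /= in_itv/= andbT ltW.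
Qed.

Lemma ld_norm_homogeneous : lipschitz_homogeneous 1 (fun v : V => `|v|).
Proof.
split => // [|v w|c v c0]; first exact: norm_continuous.
- by rewrite mul1r ler_dist_dist.
- by rewrite normrZ ger0_norm.
Qed.

Lemma ld_linear_homogeneous (phi : {linear V -> R^o}) : continuous phi ->
  exists C, lipschitz_homogeneous C phi.
Proof.
move=> cphi; have [C C0 phiC] := continuous_linear_lipschitz cphi.
by exists C; split => // c v c0; rewrite linearZ.
Qed.

Lemma le_eps_mul (x c : R) : 0 <= c -> (forall e, 0 < e -> x <= c * e) -> x <= 0.
Proof.
move=> c0 xc; apply/ler_addgt0Pr => e e0; rewrite add0r.
(* The summand 1 keeps the denominator positive when [c] is 0. *)
apply: le_trans (xc (e / (c + 1)) _) _.
  by rewrite divr_gt0// ltr_wpDl.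
rewrite mulrCA ger_pMr// ler_pdivrMr ?ltr_wpDl// mul1r.
by rewrite lerDl.
Qed.

(** For linear [phi] the sum over cells in [cell_approx] is exactly [phi (m A)], whatever the mesh,
    so the error bound can be sent to 0. *)
Lemma ld_linear_integral (phi : {linear V -> R^o}) (a : R) A :
  continuous phi -> 0 < a -> lebesgue_sets R A ->
  A `<=` [set` `[a, +oo[ : interval R] ->
  \int[lambda]_(x in A) phi (F x) = phi (m A) :> R.
Proof.
move=> cphi a0 lA Aa; have [C Cphi] := ld_linear_homogeneous cphi.
have [C0 _ _ _] := Cphi.
apply/esym/eqP; rewrite -subr_eq0 -normr_le0.
apply: (@le_eps_mul _ (2 * C)) => [|e e0]; first by rewrite mulr_ge0.
have [N /(_ N (leqnn N) A lA Aa)] := cell_approx mF Cphi a0 e0.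
rewrite -raddf_sum (ld_cells mF)// => /le_trans; apply.
by rewrite ler_piMr ?mes_le1// !mulr_ge0// ltW.
Qed.

Lemma ld_measurable_norm : measurable_fun (I01 R) (fun x => `|F x|).
Proof. by apply: (ld_measurable mF (g := fun v => `|v|)); exact: norm_continuous. Qed.

(** The norm of [F] may fail to be integrable, so no domination by it is available. Instead, on each
    tail the integral of [|phi (F x)|] is split by the sign of [phi (F x)]; each part is plus or
    minus the value of [phi] at some [m B], and these are uniformly bounded since [m] is. Monotone
    convergence passes the bound to [0,1]. *)
Lemma ld_integrable_linear (phi : {linear V -> R^o}) : continuous phi ->
  lambda.-integrable (I01 R) (fun x => (phi (F x))%:E).
Proof.
move=> cphi; have [C Cphi] := ld_linear_homogeneous cphi.
have [C0 _ phiC _] := Cphi.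
have [M mM] := ld_bounded mF.
have mphi := ld_measurable mF cphi.
apply/integrableP; split; first exact/measurable_EFinP.
have phiM B : lebesgue_sets R B -> `|phi (m B)| <= C * M.
  move=> lB; have := phiC (m B) 0; rewrite linear0 !subr0 => /le_trans; apply.
  by rewrite ler_wpM2l// mM.
apply: (@le_lt_trans _ _ (C * M + C * M)%:E); last by rewrite ltry.
have mabs : measurable_fun (I01 R) (fun x => `|phi (F x)|).
  exact: measurableT_comp mphi.
have cv := integral_tail_cvg (leb_I01 (R := R)) mabs (fun x => normr_ge0 _).
under eq_integral do rewrite abse_EFin.
apply: (lee_cvg_to cv (cvg_cst _)); apply: nearW => n.
pose T := tail (I01 R) n; have lT : lebesgue_sets R T by exact: leb_tail leb_I01.
pose P : set (lebT R) := T `&` [set x | 0 <= phi (F x)].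
have lP : lebesgue_sets R P.
  split; last by move=> x [[]].
  have -> : P = T `&` (fun x => phi (F x) : R) @^-1` [set` `[0, +oo[].
    by apply/seteqP; split => x [Tx] /=; rewrite in_itv/= andbT => ?; split.
  have mphiT : measurable_fun T (fun x => phi (F x) : R).
    by apply: measurable_funS mphi; [exact: measurable_I01|exact: lT.2].
  by apply: mphiT; [exact: leb_measurable|exact: measurable_itv].
have PT : P `<=` T by move=> x [].
have lTP : lebesgue_sets R (T `\` P) by exact: leb_setD lT (leb_measurable lP).
have n0 : 0 < n.+1%:R^-1 :> R by rewrite invr_gt0.
have int B : lebesgue_sets R B -> B `<=` T ->
    lambda.-integrable B (fun x => (phi (F x))%:E).
  move=> lB BT; apply: (ld_integrable mF Cphi n0 lB).
  by move=> x /BT[].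
have val B : lebesgue_sets R B -> B `<=` T ->
    (\int[lambda]_(x in B) (phi (F x))%:E = (phi (m B) : R)%:E)%E.
  move=> lB BT; rewrite -(ld_linear_integral cphi n0 lB); last by move=> x /BT[].
  rewrite fineK//; apply: integrable_fin_num; first exact: leb_measurable.
  exact: int.
rewrite -[X in (\int[lambda]_(x in X) _)%E](setDUK PT) ge0_integral_setU.
- rewrite EFinD; apply: leeD.
    under eq_integral => x /set_mem [_ /= x0] do rewrite ger0_norm//.
    by rewrite val// lee_fin (le_trans (ler_norm _))// phiM.
  rewrite (eq_integral (fun x => - (phi (F x))%:E)%E).
    have iTP := int _ lTP (@subDsetl _ _ _).
    have mTP := leb_measurable lTP.
    rewrite integralN/=; last by apply: integrable_add_def.
    rewrite (val _ lTP (@subDsetl _ _ _)).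
    by rewrite -EFinN lee_fin (le_trans (ler_norm _))// normrN phiM.
  move=> x /set_mem [Tx Px]; rewrite -EFinN ltr0_norm// ltNge.
  by apply/negP => x0; apply: Px.
- exact: leb_measurable.
- exact: leb_measurable.
- rewrite (setDUK PT); apply/measurable_EFinP; apply: measurable_funS mabs.
    exact: measurable_I01.
  exact: lT.2.
- by move=> *; rewrite lee_fin.
- by rewrite disj_set2E setDIK.
Qed.

(** The identity holds on tails. The integrals converge by domination by [|phi (F x)|], now known to
    be integrable, and [m (tail A n)] converges to [m A] in norm by [ld_tail]. *)
Lemma ld_pettis_integral A : lebesgue_sets R A -> is_pettis_integral F A (m A).
Proof.
move=> lA phi cphi.
have mA := leb_measurable lA.
have iA : lambda.-integrable A (fun x => (phi (F x))%:E).
  apply: integrableS (ld_integrable_linear cphi) => //.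
    exact: measurable_I01.
  exact: lA.2.
split => //.
have mphi := measurable_int _ iA.
have mT n : measurable (tail A n) by exact: leb_measurable (leb_tail n lA).
have := @dominated_convergence _ _ _ lambda A mA
  (fun n => (fun x => (phi (F x))%:E) \_ (tail A n))
  (fun x => (phi (F x))%:E) (fun x => `|(phi (F x))%:E|%E).
case.
- move=> n.
  apply/measurable_restrict => //.
  by apply: measurable_funS mphi => //; exact: subIsetl.
- by [].
- apply: filterS (ae_I01_gt0 (R := R)) => x x0 Ax.
  have {}x0 := x0 (lA.2 _ Ax).
  have [N NP] := natSinv_small x0.
  apply: cvg_near_cst; exists N => // n /= /NP nx.
  by rewrite patchE mem_set//; split => //; rewrite /= in_itv/= andbT.
- exact: integrable_abse iA.
- apply: aeW => x n Ax; rewrite patchE; case: ifPn => // _.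
  by rewrite abse0 abse_ge0.
move=> _ _ cv.
apply: (cvg_unique _ cv) => //=.
have -> : (fun n => \int[lambda]_(x in A) ((fun x => (phi (F x))%:E) \_ (tail A n)) x)%E
    = (fun n => (phi (m (tail A n)) : R)%:E).
  apply/funext => n; rewrite -integral_mkcondr (_ : A `&` _ = tail A n); last first.
    by apply/setIidPr; exact: tail_subl.
  have n0 : 0 < n.+1%:R^-1 :> R by rewrite invr_gt0.
  rewrite -(ld_linear_integral cphi n0 (leb_tail n lA)); last exact: tail_sub.
  rewrite fineK//; apply: integrable_fin_num => //.
  by apply: integrableS iA => //; exact: tail_subl.
have cm : m (tail A n) @[n --> \oo] --> m A.
  apply/cvgrPdist_le => e e0; have [N NP] := ld_tail e0.
  by exists N => // n /= /NP; exact.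
have cphim : (phi (m (tail A n)) : R^o) @[n --> \oo] --> (phi (m A) : R^o).
  by apply: (cvg_comp _ _ cm); exact: cphi.
apply/cvg_EFin; first exact: nearW.
exact: cphim.
Qed.

End local_density_integrals.

(** * Countable additivity, variation and Bochner integrability *)

Section local_density_variation.
Context {R : realType} {V : normedModType R}.
Variables (m : set (lebT R) -> V) (F : lebT R -> V).
Hypothesis mF : local_density m F.
Implicit Types A B : set (lebT R).

(** The remainder is [m] of the union minus the first n sets; its Lebesgue measure tends to 0 by
    continuity from below, so [ld_small] applies. *)
Lemma ld_sigma_additive : vector_sigma_additive m.
Proof.
move=> A lA tA; have lU := leb_bigcup lA.
apply/cvgrPdist_le => e e0; have [d d0 md] := ld_small mF e0.
have lS n := leb_bigsetU n lA.
have mS n := leb_measurable (lS n).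
have : lambda (\big[setU/set0]_(i < n) A i) @[n --> \oo] --> lambda (\bigcup_n A n).
  rewrite -bigcup_bigsetU_bigcup -(cvg_shiftS (fun n => lambda (\big[setU/set0]_(i < n) A i))).
  apply: (nondecreasing_cvg_mu (mu := lambda) (F := fun n => \big[setU/set0]_(i < n.+1) A i)).
  - by move=> n; exact: mS.
  - by apply: bigcupT_measurable => n; exact: mS.
  - by move=> n k nk; rewrite subsetEset; apply: subset_bigsetU; rewrite ltnS.
rewrite (mesE lU).
have -> : (fun n => lambda (\big[setU/set0]_(i < n) A i)) =
    (fun n => (mes (\big[setU/set0]_(i < n) A i))%:E).
  by apply/funext => n; exact: mesE.
move=> /fine_cvgP[_] /cvgrPdist_le /(_ d d0); apply: filterS => n nd.
have SU : \big[setU/set0]_(i < n) A i `<=` \bigcup_n A n by exact: bigsetU_bigcup.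
rewrite -(ld_bigsetU mF n lA tA) (ld_setD mF lU (lS n) SU).
have lD := leb_setD lU (mS n).
apply: md => //; apply: le_trans (le_trans (ler_norm _) nd).
by rewrite /= -{2}(setDUK SU) mesU// ?setDIK// [leRHS]addrAC subrr add0r.
Qed.

(** On a tail, the triangle inequality over cells bounds the norm of [m] by the sum that
    [cell_approx] compares with the integral; the rest of [A] costs at most [e]. *)
Lemma ld_norm_le_integral A : lebesgue_sets R A ->
  (`|m A|%:E <= \int[lambda]_(x in A) (`|F x|)%:E)%E.
Proof.
move=> lA; apply/lee_addgt0Pr => e e0.
have [N /(_ N (leqnn N) A lA) NA] := ld_tail mF e0.
apply: (@le_trans _ _ (`|m (tail A N)| + e)%:E).
  by rewrite lee_fin -lerBlDl (le_trans _ NA)// lerB_dist.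
rewrite EFinD leeD2r//.
have lT := leb_tail N lA; have N0 : 0 < N.+1%:R^-1 :> R by rewrite invr_gt0.
have iT := ld_integrable mF ld_norm_homogeneous N0 lT (@tail_sub _ A N).
apply: (@le_trans _ _ (\int[lambda]_(x in tail A N) (`|F x|)%:E)%E); last first.
  apply: ge0_subset_integral; [exact: leb_measurable|exact: leb_measurable| |by []|exact: tail_subl].
  apply/measurable_EFinP; apply: measurable_funS (ld_measurable_norm mF).
    exact: measurable_I01.
  exact: lA.2.
rewrite -[leRHS]fineK; last by apply: integrable_fin_num iT; exact: leb_measurable.
rewrite lee_fin -subr_le0.
apply: (@le_eps_mul _ _ (2 * 1)) => // c c0.
have [n /(_ n (leqnn n) _ lT (@tail_sub _ A N))] := cell_approx mF ld_norm_homogeneous N0 c0.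
set S := \sum_(i < _) _ => Sc.
have mS : `|m (tail A N)| <= S by rewrite -(ld_cells mF n lT); exact: ler_norm_sum.
apply: le_trans (lerB mS (lexx _)) _.
apply: le_trans (ler_norm _) _; apply: le_trans Sc _.
by rewrite ler_piMr ?mes_le1// !mulr_ge0// ltW.
Qed.

Lemma variation_le_integral A : lebesgue_sets R A ->
  (vector_variation m A <= \int[lambda]_(x in A) (`|F x|)%:E)%E.
Proof.
move=> lA; apply: ge_ereal_sup => _ [[n P] /= [lP tP PA] <-].
(* Only the first [n] sets of [P] are constrained; the others are replaced by the empty set. *)
pose Q i : set (lebT R) := if (i < n)%N then P i else set0.
have lQ i : lebesgue_sets R (Q i).
  by rewrite /Q; case: ifPn => [/lP//|_]; exact: leb_set0.
have QA : \big[setU/set0]_(i <- iota 0 n) Q i = A.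
  have -> : iota 0 n = index_iota 0 n by rewrite /index_iota subn0.
  rewrite big_mkord -PA bigcup_mkord; apply: eq_bigr => i _.
  by rewrite /Q ltn_ord.
rewrite -QA ge0_integral_bigsetU ?iota_uniq//.
- have -> : iota 0 n = index_iota 0 n by rewrite /index_iota subn0.
  rewrite big_mkord -sumEFin; apply: lee_sum => i _.
  by rewrite /Q ltn_ord; apply: ld_norm_le_integral; exact: lP.
- by move=> i; exact: leb_measurable.
- move=> i j; rewrite /= !mem_iota /= !add0n => i_n jn; rewrite /Q i_n jn.
  exact: tP.
- rewrite QA; apply/measurable_EFinP; apply: measurable_funS (ld_measurable_norm mF).
    exact: measurable_I01.
  exact: lA.2.
Qed.

(** The cells of a tail, together with the rest of [A] as the last set, form an admissible partition
    whose sum of norms nearly reaches the integral over the tail. *)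
Lemma integral_le_variation A : lebesgue_sets R A ->
  (\int[lambda]_(x in A) (`|F x|)%:E <= vector_variation m A)%E.
Proof.
move=> lA.
apply: (lee_cvg_to (integral_tail_cvg lA (ld_measurable_norm mF) _) (cvg_cst _)) => //.
apply: nearW => k; set T := tail A k.
have lT : lebesgue_sets R T := leb_tail k lA.
have k0 : 0 < k.+1%:R^-1 :> R by rewrite invr_gt0.
have iT := ld_integrable mF ld_norm_homogeneous k0 lT (@tail_sub _ A k).
(* Halving [e] absorbs the factor 2 of [cell_approx]; the Lipschitz constant of the norm is 1. *)
apply/lee_addgt0Pr => e e0; have e20 : 0 < e / 2 by rewrite divr_gt0.
have [n /(_ n (leqnn n) _ lT (@tail_sub _ A k))] :=
  cell_approx mF ld_norm_homogeneous k0 e20.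
set S := \sum_(i < _) _ => Sc.
apply: (@le_trans _ _ (S + e)%:E).
  rewrite -[leLHS]fineK; last by apply: integrable_fin_num iT; exact: leb_measurable.
  rewrite lee_fin -lerBlDl; apply: le_trans (ler_norm _) _.
  rewrite distrC; apply: le_trans Sc _.
  by rewrite mulr1 mulrCA divff// mulr1 ler_piMr ?mes_le1// ltW.
rewrite EFinD leeD2r//.
pose P i := if (i < n.+2)%N then T `&` cell n i else A `\` T.
apply: (@le_trans _ _ (\sum_(i < n.+3) `|m (P i)|)%:E).
  rewrite lee_fin big_ord_recr/= ler_wpDr//.
  by rewrite /S; apply: ler_sum => i _; rewrite /P ltn_ord.
apply: ereal_sup_ubound; exists (n.+3, P) => //; split => /=.
- move=> i _; rewrite /P; case: ifPn => _; first exact: leb_cell.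
  exact: leb_setD lA (leb_measurable lT).
- move=> i j /= i_lt j_lt; rewrite /P; case: ifPn => i_n; case: ifPn => j_n.
  + exact: (cell_triv (n := n) lT.2).
  + by move=> [x [[Tx _] [_]]].
  + by move=> [x [[_ nTx] [Tx]]].
  + have last l : (l < n.+3)%N -> ~~ (l < n.+2)%N -> l = n.+2.
      by rewrite ltnS leq_eqVlt => /orP[/eqP//|->].
    by rewrite (last i)// (last j).
- rewrite bigcup_mkord big_ord_recr/= {2}/P ltnn.
  rewrite (eq_bigr (fun i : 'I_n.+2 => T `&` cell n i)); last first.
    by move=> i _; rewrite /P ltn_ord.
  rewrite (cell_cover n lT.2); apply: setDUK; exact: tail_subl.
Qed.

Lemma ld_variation A : lebesgue_sets R A ->
  vector_variation m A = (\int[lambda]_(x in A) (`|F x|)%:E)%E.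
Proof.
move=> lA; apply/eqP; rewrite eq_le variation_le_integral//.
exact: integral_le_variation.
Qed.

Lemma ld_sigma_finite_variation : sigma_finite_variation m.
Proof.
(* The point 0 is added because no tail contains it. *)
pose G n : set (lebT R) := [set (0 : R)] `|` tail (I01 R) n.
have m0 : measurable ([set (0 : R)] : set (lebT R)).
  exact: borel_lebesgue (measurable_set1 0).
have l0 : lebesgue_sets R [set (0 : R)].
  by split => // x ->; rewrite /I01 /= lexx ler01.
have lG n : lebesgue_sets R (G n) by apply: leb_setU => //; exact: leb_tail leb_I01.
exists G.
  apply/seteqP; split => [x Ix|x [n _]]; last exact: (lG n).2.
  have [x0|x0] := pselect (x = (0 : R)); first by exists 0%N => //; left.
  have [n _ nx] : (\bigcup_n tail (I01 R) n) x by rewrite tail_bigcup.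
  by exists n => //; right.
move=> n; split; first exact: leb_measurable.
rewrite ld_variation//.
have n0 : 0 < n.+1%:R^-1 :> R by rewrite invr_gt0.
have : lambda.-integrable (G n) (EFin \o (fun x => `|F x|)).
  apply: measurable_bounded_integrable.
  - exact: leb_measurable.
  - exact: leb_ltoo.
  - apply: measurable_funS (ld_measurable_norm mF); first exact: measurable_I01.
    exact: (lG n).2.
  (* The first term covers the point 0, the second the tail, where the norm of [F] is largest at the
     left end. *)
  exists (`|F (0 : R)| + `|F (n.+1%:R^-1 : R)|); split => [|M /ltW FM x]; first exact: num_real.
  move=> Gx; rewrite /= normr_id; apply: le_trans FM.
  case: Gx => [->|[_]]; first by rewrite lerDl.
  rewrite /= in_itv/= andbT => nx; rewrite ler_wpDl//.
  by apply: (ld_decr mF); rewrite n0.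
move=> /integrableP[_]; apply: le_lt_trans.
by under [leRHS]eq_integral do rewrite abse_EFin normr_id.
Qed.

Definition step n (y : lebT R) : V := F (up_grid n y).

Lemma simple_step n : simple_function (step n).
Proof.
split.
  apply: (sub_finite_set _ (finite_image (fun i => F (grid n i)) (finite_II n.+2))).
  move=> _ [x /andP[x0 x1] <-]; exists (Num.truncn ((x : R) * n.+1%:R)) => //=.
  rewrite truncn_lt_nat ?mulr_ge0// (@le_lt_trans _ _ n.+1%:R)// ?ltr_nat//.
  by rewrite -[leRHS]mul1r ler_wpM2r.
move=> v; have -> : I01 R `&` step n @^-1` [set v] =
    \bigcup_(i in [set i | F (grid n i) = v]) (I01 R `&` cell n i).
  apply/seteqP; split => x.
    move=> [Ix /= xv]; exists (Num.truncn ((x : R) * n.+1%:R)) => //; split => //.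
    by apply/cellP => //; case/andP: Ix.
  move=> [i /= iv [Ix xi]]; split => //=; rewrite -iv /step /up_grid.
  by rewrite ((cellP n i _).1 xi)//; case/andP: Ix.
by apply: bigcup_measurable => i _; exact: leb_measurable (leb_cell n i leb_I01).
Qed.

Lemma step_cvg (x : R) : 0 < x -> step n x @[n --> \oo] --> F x.
Proof.
move=> x0; apply/cvgrPdist_le => e e0.
have [h h0 hF] := ld_local mF x0 e0; have [N NP] := natSinv_small h0.
exists N => // n /= /NP nh; have /andP[x1 x2] := up_gridP n (ltW x0).
apply: (hF _ (grid_gt0 _ _)).1 => //; rewrite (ltW x2) andbT (le_trans _ x1)//.
by rewrite lerD2l lerN2.
Qed.

Lemma ld_strongly_measurable : strongly_measurable F.
Proof.
exists step; split; first exact: simple_step.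
by apply: filterS (ae_I01_gt0 (R := R)) => x x0 /x0; exact: step_cvg.
Qed.

Lemma measurable_step n : measurable_fun (I01 R) (fun x => `|F x - step n x|).
Proof.
have -> : I01 R = \bigcup_i (I01 R `&` cell n i).
  apply/seteqP; split => [x Ix|x [i _ []]//].
  exists (Num.truncn ((x : R) * n.+1%:R)) => //; split => //.
  by apply/cellP => //; case/andP: Ix.
apply/measurable_fun_bigcup => [i|i]; first exact: leb_measurable (leb_cell n i leb_I01).
apply: (eq_measurable_fun (fun x => `|F x - F (grid n i)|)).
  move=> x /set_mem[/andP[x0 _] xi]; rewrite /step /up_grid.
  by rewrite ((cellP n i x0).1 xi).
have mg : measurable_fun (I01 R) (fun x => `|F x - F (grid n i)|).
  apply: (ld_measurable mF (g := fun v => `|v - F (grid n i)|)) => v.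
  by apply: cvg_norm; apply: cvgB; [exact: cvg_id|exact: cvg_cst].
by apply: measurable_funS mg; [exact: measurable_I01|exact: subIsetl].
Qed.

(** By [ld_variation], finite variation says that the norm of [F] is integrable. Since [up_grid n y]
    lies to the right of [y], the norm of [step n y] is at most that of [F y], so twice the norm of
    [F] dominates the differences. *)
Lemma ld_bochner : finite_variation m -> bochner_integrable F.
Proof.
rewrite /finite_variation ld_variation; last exact: leb_I01.
move=> fin; split; first exact: ld_strongly_measurable.
exists step; split; first exact: simple_step.
have mI := leb_measurable (leb_I01 (R := R)).
have mn := ld_measurable_norm mF.
have iF : lambda.-integrable (I01 R) (EFin \o (fun x => `|F x|)).
  apply/integrableP; split; first exact/measurable_EFinP.
  apply: le_lt_trans fin.
  by under [leLHS]eq_integral do rewrite abse_EFin normr_id.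
have := @dominated_convergence _ _ _ lambda (I01 R) mI
  (fun n x => (`|F x - step n x|)%:E) (cst 0%E)
  (fun x => (`|F x| + `|F x|)%:E).
case.
- by move=> n; apply/measurable_EFinP; exact: measurable_step.
- exact: measurable_cst.
- apply: filterS (ae_I01_gt0 (R := R)) => x x0 /x0 {}x0.
  apply/cvg_EFin; first exact: nearW.
  have := step_cvg x0 => /(cvgB (cvg_cst (F x))) /(cvg_norm).
  by rewrite subrr normr0.
- exact: (integrableD mI iF iF).
- apply: filterS (ae_I01_gt0 (R := R)) => x x0 n /x0 {}x0.
  rewrite abse_EFin normr_id lee_fin (le_trans (ler_normB _ _))// lerD2l.
  apply: (ld_decr mF); rewrite x0 ltW//.
  by have /andP[] := up_gridP n (ltW x0).
- by move=> _ _; rewrite integral0.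
Qed.

End local_density_variation.

(** * Relative compactness of the range *)

(** The finite net consists of combinations of the grid values of [F] with coefficients in multiples
    of 1/(K+1). Three errors of [e / 3] arise: passing to a tail, replacing [m] on each cell by its
    measure times the grid value, and rounding these measures. *)
Lemma ld_precompact (R : realType) (V : completeNormedModType R)
    (m : set (lebT R) -> V) (F : lebT R -> V) :
  local_density m F -> precompact (m @` lebesgue_sets R).
Proof.
move=> mF; apply: totally_bounded_precompact => e e0.
have e30 : 0 < e / 3 by rewrite divr_gt0.
have [k /(_ k (leqnn k)) mk] := ld_tail mF e30.
have k0 : 0 < k.+1%:R^-1 :> R by rewrite invr_gt0.
have [h h0 hF] := ld_local mF k0 e30.
have [n /(_ n (leqnn n)) nh] := natSinv_small h0.
pose W := \sum_(i < n.+2) `|F (grid n i)|.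
have W0 : 0 <= W by exact: sumr_ge0.
have W10 : 0 < W + 1 by rewrite ltr_wpDl.
have eW0 : 0 < e / 3 / (W + 1) by rewrite divr_gt0.
have [K /(_ K (leqnn K)) KW] := natSinv_small eW0.
pose comb (c : {ffun 'I_n.+2 -> 'I_K.+2}) : V :=
  \sum_(i < n.+2) ((c i)%:R / K.+1%:R) *: F (grid n i).
exists (range comb); first exact: finite_image finite_finset.
move=> _ [A lA <-]; set T := tail A k; have lT : lebesgue_sets R T := leb_tail k lA.
(* Cell measures are rounded down; being at most 1, they give numerators from 0 to K+1. *)
pose t (i : 'I_n.+2) := Num.truncn (mes (T `&` cell n i) * K.+1%:R).
have tK i : (t i < K.+2)%N.
  rewrite /t truncn_lt_nat ?mulr_ge0 ?mes_ge0//.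
  rewrite (@le_lt_trans _ _ K.+1%:R)// ?ltr_nat//.
  by rewrite -[leRHS]mul1r ler_wpM2r// mes_le1//; exact: leb_cell.
pose c := [ffun i => Ordinal (tK i)].
exists (comb c); first by exists c.
have -> : e = e / 3 + e / 3 + e / 3 by lra.
rewrite -(subrKA (\sum_(i < n.+2) mes (T `&` cell n i) *: F (grid n i))).
rewrite -[m A - _](subrKA (m T)).
apply: le_trans (ler_normD _ _) _; apply: lerD.
  apply: le_trans (ler_normD _ _) _; apply: lerD; first exact: mk.
  rewrite -(ld_cells mF n lT) -sumrB.
  apply: (@le_trans _ _ (e / 3 * mes T)); last by rewrite ler_piMr ?mes_le1// ltW.
  rewrite -(mes_cells n lT) mulr_sumr.
  apply: le_trans (ler_norm_sum _ _ _) _; apply: ler_sum => i _.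
  apply: (hF _ (grid_gt0 _ _)).2; first exact: leb_cell.
  move=> y [[_ /=]]; rewrite in_itv/= andbT => -> /cell_grid/andP[y1 ->].
  by split => //; rewrite andbT (le_trans _ y1)// lerD2l lerN2.
rewrite -sumrB; apply: le_trans (ler_norm_sum _ _ _) _.
apply: (@le_trans _ _ (K.+1%:R^-1 * W)).
  rewrite mulr_sumr; apply: ler_sum => i _.
  rewrite -scalerBl normrZ ler_wpM2r// ffunE /=.
  have /andP[t1 t2] : (t i)%:R <= mes (T `&` cell n i) * K.+1%:R < (t i).+1%:R.
    by apply: truncn_itv; rewrite mulr_ge0 ?mes_ge0.
  rewrite ger0_norm ?subr_ge0 ?ler_pdivrMr//.
  rewrite lerBlDl -[X in _ + X]mul1r -mulrDl ler_pdivlMr//.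
  by rewrite natr1 ltW.
apply: le_trans (ler_wpM2r W0 KW) _.
by rewrite mulrAC ler_pdivrMr// ler_wpM2l ?lerDl// ltW.
Qed.

(** * Norm estimates in the rearrangement invariant space *)

Section banach_function_space_theory.
Context {R : realType} {X : completeNormedModType R}.
Variable rep : X -> lebT R -> R.
Hypothesis hX : rearrangement_invariant rep.
Let hB := ri_bfs hX.

Lemma repD (f g : X) : eq01 (rep (f + g)) (fun x => rep f x + rep g x).
Proof.
have := bfs_linear hB 1 f g; rewrite scale1r.
by apply: filterS => x + Ix => /(_ Ix) ->; rewrite mul1r.
Qed.

Lemma repZ (a : R) (f : X) : eq01 (rep (a *: f)) (fun x => a * rep f x).
Proof.
have := bfs_linear hB a f 0; rewrite addr0.
by apply: filterS2 (rep0 hB) => x + + Ix => /(_ Ix) -> /(_ Ix) ->; rewrite addr0.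
Qed.

Lemma repB (f g : X) : eq01 (rep (f - g)) (fun x => rep f x - rep g x).
Proof.
rewrite -scaleN1r; apply: filterS2 (repD f (-1 *: g)) (repZ (-1) g).
by move=> x + + Ix => /(_ Ix) -> /(_ Ix) ->; rewrite mulN1r.
Qed.

Lemma bfs_norm_le (f g : X) :
  le01 (fun x => `|rep f x|) (fun x => `|rep g x|) -> `|f| <= `|g|.
Proof.
move=> /(bfs_ideal hB (bfs_measurable hB f))[h hf].
by have -> : h = f by exact: (bfs_inj hB).
Qed.

(** The distribution function of M times the indicator of [B] vanishes from level [M] on, and below
    [M] it is the measure of [B], at most that of the set where [|f|] exceeds the lower level.
    Rearrangements are then ordered the same way. *)
Lemma ri_indic (f : X) (M : R) (B : set (lebT R)) : 0 < M -> measurable B ->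
  (lambda (I01 R `&` B) <= lambda (I01 R `&` [set x | (M < `|rep f x|)%R]))%E ->
  exists2 h : X, eq01 (rep h) (fun x => M * \1_B x) & `|h| <= `|f|.
Proof.
move=> M0 mB BM; have mI := @measurable_I01 R.
have mg : measurable_fun (I01 R) (fun x => M * \1_B x).
  by apply: (measurable_funM (f := cst M)) => //; exact: measurable_indic.
have msup (k : lebT R -> R) t : measurable_fun (I01 R) k ->
    measurable (I01 R `&` [set x | t < `|k x|]).
  move=> mk; have mk' : measurable_fun (I01 R) (fun x => `|k x|).
    exact: measurableT_comp mk.
  rewrite (_ : [set x | _] = (fun x => `|k x|) @^-1` [set` `]t, +oo[]).
    by apply: mk' => //; exact: measurable_itv.
  by apply/seteqP; split => x /=; rewrite in_itv/= andbT.
apply: (ri_rearrangement hX mg) => t /andP[t0 _].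
apply: ereal_inf_le_tmp => _ [tau [tau0 tauf] <-]; exists tau => //; split => //.
have [tM|Mt] := ltP tau M.
  apply: le_trans tauf; apply: le_trans (le_trans BM _).
    apply: le_measure; rewrite ?inE; [exact: msup mg|exact: measurableI|].
    move=> x [Ix /=]; rewrite indicE; have [/set_mem Bx _|_] := boolP (x \in B); first by split.
    by rewrite mulr0 normr0 ltNge tau0.
  apply: le_measure; rewrite ?inE; [exact: msup (bfs_measurable hB f)..|].
  by move=> x [Ix /= Mx]; split => //=; exact: lt_trans Mx.
rewrite (_ : _ `&` _ = set0) ?measure0 ?lee_fin//.
apply/seteqP; split => x //= [_].
rewrite normrM gtr0_norm// indicE; case: (x \in B) => /=.
  by rewrite normr1 mulr1 ltNge Mt.
by rewrite normr0 mulr0 ltNge tau0.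
Qed.

Hypothesis hXLinfty : ~ is_Linfty rep.

(** Bounded functions always belong to the space, so it can differ from L^oo only by containing an
    unbounded one. *)
Lemma exists_unbounded : exists f : X, ~ essentially_bounded (rep f).
Proof.
apply: contrapT => nf; apply: hXLinfty => f mf; split => [[g gf]|]; last first.
  exact: ri_Linfty.
have [M gM] : essentially_bounded (rep g) by apply: contrapT => ng; apply: nf; exists g.
by exists M; apply: filterS2 gf gM => x + + Ix => /(_ Ix) <- /(_ Ix).
Qed.

Lemma indic_small (e : R) : 0 < e -> exists2 d : R, 0 < d &
  forall B, measurable B -> (lambda (I01 R `&` B) <= d%:E)%E ->
  exists2 b : X, eq01 (rep b) \1_B & `|b| <= e.
Proof.
move=> e0; have [f fu] := exists_unbounded.
(* With this level, [|f| <= M * e], so dividing by [M] brings the norm below [e]; the summand 1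
   makes [M] positive. *)
pose M := `|f| / e + 1; have M0 : 0 < M by rewrite ltr_wpDl// divr_ge0// ltW.
pose E : set (lebT R) := I01 R `&` [set x | M < `|rep f x|].
have lE : lebesgue_sets R E.
  split; last by move=> x [].
  have mf : measurable_fun (I01 R) (fun x => `|rep f x|).
    exact: measurableT_comp (bfs_measurable hB f).
  rewrite /E (_ : [set x | _] = (fun x => `|rep f x|) @^-1` [set` `]M, +oo[]).
    by apply: mf; [exact: measurable_I01|exact: measurable_itv].
  by apply/seteqP; split => x /=; rewrite in_itv/= andbT.
(* If [E] were null, [M] would be an essential bound of [f]. *)
have E0 : 0 < mes E.
  rewrite lt_neqAle mes_ge0 andbT eq_sym; apply/eqP => mE0; apply: fu; exists M.
  exists E; split; [exact: leb_measurable|by rewrite mesE// mE0|].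
  move=> x /= /not_implyP[Ix /negP]; rewrite -ltNge => Mx; split => //.
exists (mes E) => // B mB BE.
have [|h hh hf] := @ri_indic f M B M0 mB; first by rewrite -/E (mesE lE).
exists (M^-1 *: h).
  apply: filterS2 (repZ M^-1 h) hh => x + + Ix => /(_ Ix) -> /(_ Ix) ->.
  by rewrite mulKf// gt_eqF.
rewrite normrZ ger0_norm ?invr_ge0 ?(ltW M0)// ler_pdivrMl//.
apply: le_trans hf _; rewrite mulrDl divfK ?gt_eqF// lerDl mul1r ltW//.
Qed.

(** This converts pointwise bounds into norm bounds. The threshold [d] depends on [e] alone, so the
    height [c] may vary with the set measured; [K] comes from the norm of the constant 1. *)
Lemma norm_small : exists2 K : R, 0 < K & forall e : R, 0 < e ->
  exists2 d : R, 0 < d & forall B, measurable B ->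
    (lambda (I01 R `&` B) <= d%:E)%E ->
    forall (c k : R) (g : X), 0 <= c -> 0 <= k ->
      le01 (fun x => `|rep g x|) (fun x => c * \1_B x + k) ->
      `|g| <= c * e + k * K.
Proof.
have [u u1] : in_space rep (cst 1).
  apply: ri_Linfty => //; exists 1; apply: aeW => x _.
  by rewrite /= normr1.
exists (`|u| + 1) => [|e e0]; first by rewrite ltr_wpDl.
have [d d0 db] := indic_small e0; exists d => // B mB Bd c k g c0 k0 gB.
have [b b1 be] := db B mB Bd.
apply: (@le_trans _ _ `|c *: b + k *: u|).
  apply: bfs_norm_le.
  apply: filterS3 gB (repD (c *: b) (k *: u)) (filterI (repZ c b) (filterI (repZ k u) (filterI b1 u1))).
  move=> x gx xD [xc [xk [xb xu]]] Ix.
  rewrite (xD Ix) (xc Ix) (xk Ix) (xb Ix) (xu Ix) mulr1.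
  exact: le_trans (gx Ix) (ler_norm _).
apply: le_trans (ler_normD _ _) _; apply: lerD.
  by rewrite normrZ ger0_norm// ler_wpM2l.
by rewrite normrZ ger0_norm// ler_wpM2l// lerDl.
Qed.

(** For [y <= 0] the formula is 1/x on all of [0,1], which need not lie in the space, hence the
    default 0. Points beyond 1 are allowed because grid points may exceed 1; the class there is
    0. *)
Definition cesaro_density (y : lebT R) : X :=
  if 0 < (y : R)
  then space_class rep (fun x => (x : R)^-1 * \1_[set z : R | y <= z <= 1] x)
  else 0.

Lemma cesaro_densityE (y : R) : 0 < y ->
  eq01 (rep (cesaro_density y)) (fun x => (x : R)^-1 * \1_[set z : R | y <= z <= 1] x).
Proof.
move=> y0; rewrite /cesaro_density y0.
pose k (x : lebT R) : R := (x : R)^-1 * \1_[set z : R | y <= z <= 1] x.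
suff /(xgetPex 0) : exists g, [set g : X | eq01 (rep g) k] g by [].
have mS : measurable ([set z : R | y <= z <= 1] : set (lebT R)).
  rewrite (_ : mkset _ = [set` `[y, 1]]); first exact: lebesgue_itv.
  by apply/seteqP; split => t /=; rewrite in_itv.
apply: ri_Linfty => //.
  (* On [0,1], including 0 where both are 0, the inverse is the power of exponent -1. *)
  apply: (eq_measurable_fun (fun x : lebT R =>
      (x : R) `^ (-1) * \1_[set z : R | y <= z <= 1] x)).
    by move=> x /set_mem /andP[x0 _]; rewrite powR_inv1.
  apply: measurable_funM; last exact: measurable_indic mS.
  apply: borel_lebesgue_fun; first by rewrite I01E; exact: measurable_itv.
  exact: measurable_funTS (measurable_powR _).
exists y^-1; apply: aeW => x /andP[x0 x1]; rewrite /k indicE /=.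
have [|_] := boolP (_ \in _); last by rewrite mulr0 normr0 invr_ge0 ltW.
rewrite inE /= => /andP[yx _]; rewrite mulr1 ger0_norm ?invr_ge0//.
by rewrite lef_pV2 ?posrE// (lt_le_trans y0).
Qed.

Definition initial_mes (A : set (lebT R)) (x : R) : R :=
  mes (A `&` [set` `[0, x] : interval R]).

Lemma cesaro_measure_initial A : lebesgue_sets R A ->
  eq01 (rep (cesaro_measure rep A)) (fun x => (x : R)^-1 * initial_mes A x).
Proof.
by move=> lA; apply: filterS (cesaro_measureE hX lA) => x + Ix => /(_ Ix) ->;
  rewrite cesaro_indic.
Qed.

Lemma initial_mes_le A (x : R) : lebesgue_sets R A -> 0 <= x -> initial_mes A x <= x.
Proof.
move=> lA x0; rewrite -[leRHS]subr0; apply: mes_itv => //.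
  exact: leb_setI lA (lebesgue_itv _).
Qed.

Lemma initial_mes_le_mes A (x : R) : lebesgue_sets R A -> initial_mes A x <= mes A.
Proof.
by move=> lA; apply: mes_le => //; exact: leb_setI lA (lebesgue_itv _).
Qed.

(** Both smallness estimates are pointwise bounds of the form required by [norm_small]. *)
Lemma cesaro_local_density : local_density (cesaro_measure rep) cesaro_density.
Proof.
have [K K0 small] := norm_small; split.
- move=> A B lA lB AB; apply: (bfs_inj hB).
  apply: filterS3 (repD (cesaro_measure rep A) (cesaro_measure rep B))
    (cesaro_measure_initial (leb_setU lA lB))
    (filterI (cesaro_measure_initial lA) (cesaro_measure_initial lB)).
  move=> x xD xU [xA xB] Ix; rewrite (xD Ix) (xU Ix) (xA Ix) (xB Ix) -mulrDr.
  congr (_ * _); rewrite /initial_mes setIUl mesU//.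
  + exact: leb_setI lA (lebesgue_itv _).
  + exact: leb_setI lB (lebesgue_itv _).
  + by rewrite setIACA AB set0I.
- move=> e e0; have e20 : 0 < e / 2 by rewrite divr_gt0.
  have [d d0 dK] := small _ e20.
  (* The Cesàro mean of the indicator of [A] is at most 1 on [0,d] and at most [mes A / d] beyond;
     each contributes at most [e / 2] to the norm. *)
  exists (e / 2 / K * d) => [|A lA Ad]; first by rewrite mulr_gt0// divr_gt0.
  have dE : (lambda (I01 R `&` [set` `[0%R, d] : interval R]) <= d%:E)%E.
    rewrite mesE; last exact: leb_setI leb_I01 (lebesgue_itv _).
    by rewrite lee_fin; exact: (initial_mes_le leb_I01 (ltW d0)).
  apply: le_trans (dK _ (lebesgue_itv _) dE 1 (mes A / d) _ _ _ _) _ => //.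
  + by rewrite divr_ge0 ?mes_ge0// ltW.
  + apply: filterS (cesaro_measure_initial lA) => x + Ix => /(_ Ix) ->.
    have /andP[x0 x1] := Ix.
    have i0 : 0 <= initial_mes A x by exact: mes_ge0.
    have v0 : 0 <= (x : R)^-1 by rewrite invr_ge0.
    rewrite ger0_norm ?mulr_ge0// mul1r indicE.
    have [xd|dx] := leP (x : R) d.
      rewrite mem_set /=; last by rewrite in_itv/= x0.
      rewrite ler_wpDr ?divr_ge0 ?mes_ge0 ?(ltW d0)//.
      have [->|x_neq0] := eqVneq (x : R) 0; first by rewrite invr0 mul0r.
      have xgt0 : 0 < (x : R) by rewrite lt_neqAle eq_sym x_neq0.
      by rewrite ler_pdivrMl// mulr1 initial_mes_le.
    rewrite memNset /=; last by rewrite in_itv/= x0/= leNgt dx.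
    rewrite add0r mulrC; apply: ler_pM => //; first exact: initial_mes_le_mes.
    by rewrite lef_pV2 ?posrE ?(ltW dx)// (lt_trans d0).
  + rewrite mul1r [leRHS]splitr lerD2l -ler_pdivlMr// ler_pdivrMr//.
(* Both differences below have height a multiple of [1 / a], so the indicator of [B] is made smaller
   than [a * e]. *)
- move=> a e a0 e0; have ae0 : 0 < a * e by rewrite mulr_gt0.
  have [h h0 hK] := small _ ae0; exists h => // z z0.
  pose B : set (lebT R) := [set` `[z - h, z] : interval R].
  have mB : measurable B by exact: lebesgue_itv.
  have Bh : (lambda (I01 R `&` B) <= h%:E)%E.
    have lIB := leb_setI leb_I01 mB; rewrite mesE// lee_fin.
    have -> : h = z - (z - h) by rewrite subKr.
    by apply: mes_itv => //; rewrite ?gerBl ?ltW//; exact: subIsetr.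
  have ecancel c : c / a * (a * e) + 0 * K = c * e.
    by rewrite mul0r addr0 mulrA divfK// gt_eqF.
  split.
  (* The difference is 1/x on [y,z[, a subset of [B], and 0 elsewhere on [0,1]. *)
  + move=> y ay /andP[zy yz]; have y0 := lt_le_trans a0 ay.
    apply: le_trans (hK _ mB Bh (1 / a) 0 _ _ _ _) _ => //.
    * by rewrite divr_ge0// ltW.
    * apply: filterS3 (repB (cesaro_density y) (cesaro_density z))
        (cesaro_densityE y0) (cesaro_densityE z0) => x + + + Ix.
      move=> /(_ Ix) -> /(_ Ix) -> /(_ Ix) ->; have /andP[x0 x1] := Ix.
      rewrite addr0 -mulrBr !indicE; set i := (_ \in _); set j := (_ \in _).
      have iE : i = (y <= (x : R)) by apply/idP/idP; rewrite inE /= x1 andbT.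
      have jE : j = (z <= (x : R)) by apply/idP/idP; rewrite inE /= x1 andbT.
      rewrite iE jE; have [zx|xz] := leP z (x : R).
        rewrite (le_trans yz zx) subrr mulr0 normr0 mulr_ge0//.
        by rewrite divr_ge0// ltW.
      have [yx|xy] := leP y (x : R); last first.
        rewrite subrr mulr0 normr0 mulr_ge0//.
        by rewrite divr_ge0// ltW.
      rewrite mem_set /=; last by rewrite /B /= in_itv/= (le_trans zy yx) ltW.
      rewrite subr0 !mulr1 div1r ger0_norm ?invr_ge0//.
      by rewrite lef_pV2 ?posrE// ?(le_trans ay)// (lt_le_trans y0).
    * by rewrite ecancel mul1r.
  (* For [x >= z] all of [A] lies before [x], and both terms equal [mes A / x]. To the left of [a]
     or of [z - h], both vanish. In between, only the Cesàro mean remains, at most [mes A / a]. *)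
  + move=> A lA Az.
    apply: le_trans (hK _ mB Bh (mes A / a) 0 _ _ _ _) _ => //.
    * by rewrite divr_ge0 ?mes_ge0// ltW.
    * apply: filterS3 (repB (cesaro_measure rep A) (mes A *: cesaro_density z))
        (repZ (mes A) (cesaro_density z))
        (filterI (cesaro_measure_initial lA) (cesaro_densityE z0)) => x + + + Ix.
      move=> /(_ Ix) -> /(_ Ix) -> [/(_ Ix) -> /(_ Ix) ->].
      have /andP[x0 x1] := Ix.
      have v0 : 0 <= (x : R)^-1 by rewrite invr_ge0.
      rewrite addr0 !indicE; set j := (_ \in [set z0 | _]).
      have jE : j = (z <= (x : R)) by apply/idP/idP; rewrite inE /= x1 andbT.
      have c0 : 0 <= mes A / a by rewrite divr_ge0 ?mes_ge0// ltW.
      rewrite jE; have [zx|xz] := leP z (x : R).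
        rewrite mulr1 mulrC /initial_mes (_ : _ `&` _ = A).
          by rewrite subrr normr0 mulr_ge0.
        apply/setIidPl => t At; have [at_ /andP[_ tz]] := Az _ At.
        rewrite /= in_itv/= (le_trans (ltW a0) at_)/=.
        by rewrite (le_trans (ltW tz)).
      rewrite mulr0 mulr0 subr0.
      have [[ax zx]|nx] := pselect (a <= (x : R) /\ z - h <= (x : R)).
        rewrite mem_set /=; last by rewrite /B /= in_itv/= zx ltW.
        rewrite mulr1 ger0_norm ?mulr_ge0 ?mes_ge0//.
        rewrite mulrC; apply: ler_pM => //; [exact: mes_ge0|exact: initial_mes_le_mes|].
        by rewrite lef_pV2 ?posrE// (lt_le_trans a0).
      rewrite /initial_mes (_ : _ `&` _ = set0).
        by rewrite /mes measure0 mulr0 normr0 mulr_ge0.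
      apply/seteqP; split => // t [At]; rewrite /= in_itv/= => /andP[_ tx].
      apply: nx; have [at_ /andP[zt _]] := Az _ At.
      by split; [exact: le_trans at_ tx|exact: le_trans zt tx].
    * by rewrite ecancel mulrC.
- move=> y z /andP[y0 yz]; have z0 := lt_le_trans y0 yz.
  apply: bfs_norm_le.
  apply: filterS2 (cesaro_densityE y0) (cesaro_densityE z0) => x + + Ix.
  move=> /(_ Ix) -> /(_ Ix) ->; have /andP[x0 x1] := Ix.
  rewrite !normrM ler_wpM2l// !indicE !normr_nat ler_nat.
  have [|//] := boolP (x \in [set z0 : R | z <= z0 <= 1]).
  rewrite inE /= => /andP[zx _].
  by rewrite mem_set //= x1 andbT (le_trans yz).
Qed.

End banach_function_space_theory.

Theorem theorem2p1 (R : realType) (X : completeNormedModType R)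
    (rep : X -> lebT R -> R)
    (hX : rearrangement_invariant rep) (hXLinfty : ~ is_Linfty rep) :
  let mX := cesaro_measure rep in
  (* (a) *)
  vector_sigma_additive mX /\
  (exists F : lebT R -> X,
    (* (b) *)
    [/\ forall y : R, 0 < y <= 1 ->
          eq01 (rep (F y)) (fun x => (x : R)^-1 * \1_[set z : R | y <= z <= 1] x),
        strongly_measurable F,
        pettis_density F mX,
    (* (c) *)
        sigma_finite_variation mX /\
        (forall A, lebesgue_sets R A ->
          vector_variation mX A = (\int[lambda]_(y in A) (`|F y|%R)%:E)%E) &
        (finite_variation mX -> bochner_integrable F)]) /\
  (* (d) *)
  precompact (mX @` lebesgue_sets R).
Proof.
move=> mX; have mF := cesaro_local_density hX hXLinfty.
split; first exact: ld_sigma_additive mF.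
split; last exact: ld_precompact mF.
exists (cesaro_density rep); split.
- by move=> y /andP[y0 _]; exact: cesaro_densityE.
- exact: ld_strongly_measurable mF.
- split; last by move=> A lA; exact: ld_pettis_integral.
  split=> [phi cphi|]; first exact (ld_integrable_linear mF cphi).
  by move=> A lA; exists (mX A); exact: ld_pettis_integral.
- split; first exact: ld_sigma_finite_variation mF.
  by move=> A lA; exact: ld_variation.
- exact: ld_bochner.
Qed.
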